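(* Let $D$ be a division ring that is strongly algebraic over its center $F$, let $n\ge 1$, and let $N$ be an infinite subnormal subgroup of $GL_n(D)$. If $N$ is finitely generated, then $N\subseteq F$, i.e. every element of $N$ is of the form $\alpha I$ with $\alpha\in F^*$.
   Context: For a division ring $D$ with center $F$ and $S\subseteq D$, $F(S)$ denotes the division subring of $D$ generated by $F\cup S$. If every element of $D$ is algebraic over $F$, then $D$ is called strongly algebraic over $F$ if $D$ contains a maximal subfield $K$ such that (i) there exists a subset $S$ of $K$ with $K=F(S)$, and (ii) for each $x\in D$ there are at most finitely many $y\in S$ with $xy\ne yx$. (Algebraicity of $D$ over $F$ is part of the definition.) $F^*$ is identified with the group of scalar matrices $F^*I=\{\alpha I:\alpha\in F^*\}\subseteq GL_n(D)$, where $I$ is the identity matrix. *)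

(* Defs.v *)
From HB Require Import structures.
From mathcomp Require Import all_boot all_algebra.
From mathcomp Require Import boolp classical_sets functions cardinality.

Set Implicit Arguments.
Unset Strict Implicit.
Unset Printing Implicit Defensive.

Import GRing.Theory.
Local Open Scope classical_set_scope.
Local Open Scope ring_scope.

(* A division ring is a [unitRingType] D satisfying [GRing.field_axiom D];
   nontriviality is part of [unitRingType], and commutativity is not. *)

Section DivisionRings.
Variable D : unitRingType.
Implicit Types (A K S : set D) (x : D).

Definition ring_center : set D := [set a | forall x, GRing.comm a x].

(* In a [unitRingType] 0^-1 = 0, so when D is a division ring closure under
   x / y asks nothing more than closure under division by y != 0. *)
Definition division_subring A : Prop := GRing.divring_closed (mem A).

(* F(S), where F is the center of D. *)
Definition generated_division_subring S : set D :=
  smallest division_subring (ring_center `|` S).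

Definition subfield K : Prop :=
  division_subring K /\ {in K &, forall x y, GRing.comm x y}.

Definition maximal_subfield K : Prop :=
  subfield K /\ forall L, subfield L -> K `<=` L -> L = K.

Definition algebraic_over A x : Prop :=
  exists p : {poly D}, [/\ p != 0, p \is a polyOver (mem A) & root p x].

Definition strongly_algebraic : Prop :=
  (forall x, algebraic_over ring_center x) /\
  exists2 K, maximal_subfield K &
    exists S, [/\ S `<=` K, K = generated_division_subring S &
      forall x, finite_set [set y | S y /\ ~ GRing.comm x y]].

End DivisionRings.

Arguments ring_center : clear implicits.
Arguments strongly_algebraic : clear implicits.

Section Groups.
Variable G : groupType.
Implicit Types H K X : set G.

Definition subgroup H : Prop := group_closed (mem H).

Definition generated_subgroup X : set G := smallest subgroup X.

Definition finitely_generated H : Prop :=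
  exists2 X, finite_set X & H = generated_subgroup X.

Definition normal_in H K : Prop :=
  [/\ subgroup H, subgroup K, H `<=` K &
    {in H & K, forall h k, (h ^ k)%g \in H}].

Definition subnormal H : Prop :=
  exists r (C : nat -> set G), [/\ C 0%N = H, C r = [set: G] &
    forall i, (i < r)%N -> normal_in (C i) (C i.+1)].

End Groups.

Section GeneralLinearGroup.
Variables (n : nat) (D : unitRingType).

(* The library's [unitmx] and {'GL_n[R]} need a commutative, respectively
   finite commutative, ring of entries. *)
Definition invertible_mx (A : 'M[D]_n) : Prop :=
  exists B : 'M[D]_n, A *m B = 1%:M /\ B *m A = 1%:M.

Definition GL : Type := {A : 'M[D]_n | `[< invertible_mx A >]}.

HB.instance Definition _ := SubChoice.copy GL {A : 'M[D]_n | `[< invertible_mx A >]}.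

Implicit Types g h : GL.

Lemma GL_mul_subproof g h : `[< invertible_mx (val g *m val h) >].
Proof.
case: g h => [A /= /asboolP[A' [AA' A'A]]] [B /= /asboolP[B' [BB' B'B]]].
apply/asboolP; exists (B' *m A'); split.
  by rewrite mulmxA -(mulmxA A) BB' mulmx1.
by rewrite mulmxA -(mulmxA B') A'A mulmx1.
Qed.

Lemma GL_one_subproof : `[< invertible_mx (1%:M : 'M[D]_n) >].
Proof. by apply/asboolP; exists 1%:M; rewrite mulmx1. Qed.

Lemma GL_inv_subproof g : exists h : GL,
  val g *m val h = 1%:M /\ val h *m val g = 1%:M.
Proof.
case: g => A /= /asboolP[B [AB BA]].
have invB : `[< invertible_mx B >] by apply/asboolP; exists A.
by exists (exist _ B invB).
Qed.

Definition GL_mul g h : GL := exist _ (val g *m val h) (GL_mul_subproof g h).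
Definition GL_one : GL := exist _ 1%:M GL_one_subproof.
Definition GL_inv g : GL := projT1 (cid (GL_inv_subproof g)).

Lemma GL_mulA : associative GL_mul.
Proof. by move=> f g h; apply: val_inj; rewrite /= mulmxA. Qed.

Lemma GL_mul1 : left_id GL_one GL_mul.
Proof. by move=> g; apply: val_inj; rewrite /= mul1mx. Qed.

Lemma GL_mulV : left_inverse GL_one GL_inv GL_mul.
Proof.
by move=> g; apply: val_inj; rewrite /= /GL_inv; case: cid => h [].
Qed.

Lemma GL_1mul : right_id GL_one GL_mul.
Proof. by move=> g; apply: val_inj; rewrite /= mulmx1. Qed.

Lemma GL_Vmul : right_inverse GL_one GL_inv GL_mul.
Proof.
by move=> g; apply: val_inj; rewrite /= /GL_inv; case: cid => h [].
Qed.

HB.instance Definition _ :=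
  isGroup.Build GL GL_mulA GL_mul1 GL_1mul GL_mulV GL_Vmul.

End GeneralLinearGroup.

Arguments GL : clear implicits.

(* Main.v *)
(** Entries of finitely many matrices over D lie in a division subring that is
    finite dimensional over its center: the centralizer of all but finitely many
    elements of S has this property, by Jacobson density and because K is its
    own centralizer.

    For n >= 2, a nonscalar x in N does not fix some line, and conjugating x
    repeatedly by a transvection 1 + t u produces elements of N which are
    polynomials in the central parameter t with leading coefficient of rank one.
    As N is finitely generated, their coordinates lie in a finitely generated
    subring A of the center Z.  A valuation ring V of Z containing A, at which A
    has finite residue ring, then has to be Z itself, so A and N are finite.

    For n = 1, suppose N is not commutative.  The center Z of the division ring
    spanned by N has a valuation ring V with finite residue ring on a finitely
    generated subring A over which N, the commutator of two elements of N and the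
    coordinate functions are defined.  By Wedderburn's little theorem the finite
    residue algebra has zero divisors, hence some a in D* is unbounded modulo
    Z*; then so is a x a^-1 for some x in N, and iterating along the subnormal
    chain gives an unbounded element of N, which is absurd.  So finitely
    generated subnormal subgroups are commutative.  If A and its conjugates are
    commutative and normal in the same group, then any two of their elements have
    finitely many conjugates there, which generate a finitely generated
    subnormal subgroup; hence the conjugates of A commute with each other, and
    normal closures reduce the depth of A until it is a normal commutative
    subgroup of D*, which is central. *)
Require Import Defs.
From HB Require Import structures.
From mathcomp Require Import all_boot all_algebra.
From mathcomp Require Import finfield ring zify.
From mathcomp Require Import boolp classical_sets functions cardinality.

Set Implicit Arguments.
Unset Strict Implicit.
Unset Printing Implicit Defensive.

Import GRing.Theory.
Local Open Scope classical_set_scope.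
Local Open Scope ring_scope.

(** * Subrings and the adjunction of one element *)

Section Subrings.
Context {R : nzRingType}.
Implicit Types (A : set R) (x y z : R) (p q : {poly R}).

Definition subring A : Prop :=
  [/\ A 1, forall x y, A x -> A y -> A (x - y)
    & forall x y, A x -> A y -> A (x * y)].

Lemma subring0 A : subring A -> A 0.
Proof. by case=> A1 AB _; rewrite -(subrr 1); apply: AB. Qed.

Lemma subringN A x : subring A -> A x -> A (- x).
Proof.
move=> rA Ax; rewrite -sub0r; case: (rA) => _ AB _.
by apply: AB => //; apply: subring0.
Qed.

Lemma subringD A x y : subring A -> A x -> A y -> A (x + y).
Proof.
move=> rA Ax Ay; rewrite -[y]opprK; case: (rA) => _ AB _.
by apply: AB => //; apply: subringN.
Qed.

Lemma subringM A x y : subring A -> A x -> A y -> A (x * y).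
Proof. by case=> _ _; apply. Qed.

Lemma subringX A x n : subring A -> A x -> A (x ^+ n).
Proof.
move=> rA Ax; elim: n => [|n IH]; first by rewrite expr0; case: rA.
by rewrite exprS; apply: subringM.
Qed.

Lemma subring_sum A (I : Type) (s : seq I) (P : pred I) (F : I -> R) :
  subring A -> (forall i, P i -> A (F i)) -> A (\sum_(i <- s | P i) F i).
Proof.
move=> rA AF; apply: (big_ind A) => //; first exact: subring0.
by move=> x y; apply: subringD.
Qed.

Definition coefs_in A p : Prop := forall i, A p`_i.

(** Coefficients stand to the left of the powers of [x]; [subring_adjoin] makes this a ring when [x]
    commutes with [A]. *)
Definition adjoin A x : set R := [set z | exists2 q, coefs_in A q & z = q.[x]].

Lemma coefs_inC A a : A 0 -> A a -> coefs_in A a%:P.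
Proof. by move=> A0 Aa i; rewrite coefC; case: eqP. Qed.

Lemma coefs_inX A : subring A -> coefs_in A 'X.
Proof.
move=> rA i; rewrite coefX; case: eqP => _; first by case: rA.
exact: subring0.
Qed.

Lemma coefs_inB A p q : subring A ->
  coefs_in A p -> coefs_in A q -> coefs_in A (p - q).
Proof. by move=> [_ AB _] Ap Aq i; rewrite coefB; apply: AB. Qed.

Lemma coefs_inD A p q : subring A ->
  coefs_in A p -> coefs_in A q -> coefs_in A (p + q).
Proof. by move=> rA Ap Aq i; rewrite coefD; apply: subringD. Qed.

Lemma coefs_inM A p q : subring A ->
  coefs_in A p -> coefs_in A q -> coefs_in A (p * q).
Proof.
move=> rA Ap Aq i; rewrite coefM; apply: subring_sum => // j _.
exact: subringM.
Qed.

Lemma sub_adjoin A x : subring A -> A `<=` adjoin A x.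
Proof.
move=> rA a Aa; exists a%:P; last by rewrite hornerC.
by apply: coefs_inC => //; apply: subring0.
Qed.

Lemma mem_adjoin A x : subring A -> adjoin A x x.
Proof. by move=> rA; exists 'X; [apply: coefs_inX | rewrite hornerX]. Qed.

Lemma subring_adjoin A x : subring A -> (forall a, A a -> GRing.comm a x) ->
  subring (adjoin A x).
Proof.
move=> rA Ax; split.
- by apply: sub_adjoin => //; case: rA.
- move=> _ _ [p Ap ->] [q Aq ->]; exists (p - q); first exact: coefs_inB.
  by rewrite hornerD hornerN.
- move=> _ _ [p Ap ->] [q Aq ->]; exists (p * q); first exact: coefs_inM.
  rewrite hornerM_comm //; rewrite /comm_poly !horner_coef mulr_suml mulr_sumr.
  apply: eq_bigr => i _; rewrite -mulrA -exprSr mulrA.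
  by rewrite -[x * _]Ax // -mulrA -exprS.
Qed.

Lemma adjoin_min A x B : subring B -> A `<=` B -> B x -> adjoin A x `<=` B.
Proof.
move=> rB AB Bx _ [q Aq ->]; rewrite horner_coef.
apply: subring_sum => // i _; apply: subringM => //; first exact: AB.
exact: subringX.
Qed.

End Subrings.

(** * Valuation rings *)

Section ValuationRings.
Context {Z : fieldType}.
Implicit Types (A B I J V : set Z) (x y z : Z) (p q : {poly Z}).

(** The whole field is allowed; for matrices of size at least two the proof ends by forcing [V] to
    be everything. *)
Definition valuation_ring V : Prop := subring V /\ forall z, V z \/ V z^-1.

(** The maximal ideal of [V]. The case z = 0 is listed apart because 0^-1 = 0 lies in [V]. *)
Definition nonunits V : set Z := [set z | V z /\ (z = 0 \/ ~ V z^-1)].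

Definition proper_ideal_in B J : Prop :=
  [/\ J `<=` B, J 0, forall x y, J x -> J y -> J (x + y),
      forall b x, B b -> J x -> J (b * x) & ~ J 1].

Lemma proper_ideal_sum B J (T : Type) (s : seq T) (P : pred T) (F : T -> Z) :
  proper_ideal_in B J -> (forall i, P i -> J (F i)) ->
  J (\sum_(i <- s | P i) F i).
Proof. by case=> _ J0 JD _ _ JF; apply: (big_ind J). Qed.

(** Zorn's lemma for pairs of a ring and a proper ideal of it, ordered by inclusion in both
    components. Only the maximality of the ring is recorded, as Chevalley's argument enlarges the
    ring. *)
Lemma maximal_ideal_pair A I : subring A -> proper_ideal_in A I ->
  exists B J, [/\ subring B, proper_ideal_in B J, A `<=` B, I `<=` J &
    forall B' J', subring B' -> proper_ideal_in B' J' -> B `<=` B' ->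
      J `<=` J' -> B' `<=` B].
Proof.
move=> rA iI.
pose good (t : set Z * set Z) :=
  [/\ subring t.1, proper_ideal_in t.1 t.2, A `<=` t.1 & I `<=` t.2].
pose T := {t : set Z * set Z | good t}.
pose R (s t : T) : bool :=
  `[< (sval s).1 `<=` (sval t).1 /\ (sval s).2 `<=` (sval t).2 >].
have base : good (A, I) by split.
pose t0 : T := exist _ _ base.
have R0 t : R t0 t by apply/asboolP; case: (svalP t).
have Rr t : R t t by apply/asboolP; split.
have [|F totF|[[B J] gBJ] maxt] := @ZL_preorder T t0 R Rr; last 1 first.
- case: (gBJ) => /= rB iJ AB IJ.
  exists B, J; split=> // B' J' rB' iJ' BB' JJ'.
  have gt : good (B', J').
    by split=> //; apply: subset_trans;
      [apply: AB|apply: BB'|apply: IJ|apply: JJ'].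
  have Rt : R (exist _ _ gBJ) (exist _ _ gt) by apply/asboolP.
  by have /asboolP[] := maxt _ Rt.
- move=> r s t /asboolP[a b] /asboolP[c d]; apply/asboolP.
  by split; apply: subset_trans; eassumption.
(* Adding the bottom pair [t0] gives a nonempty chain even when [F] is empty, so the unions below
   contain 1 and 0. *)
- pose F' := F `|` [set t0].
  have totF' s t : F' s -> F' t -> exists2 u, F' u & R s u /\ R t u.
    case=> [Fs|->]; last by move=> F't; exists t.
    case=> [Ft|->]; last by exists s; [left|].
    by have [st|ts] := totF _ _ Fs Ft; [exists t|exists s]; rewrite /F' /=; auto.
  pose B : set Z := [set z | exists2 t, F' t & (sval t).1 z].
  pose J : set Z := [set z | exists2 t, F' t & (sval t).2 z].
  have F't0 : F' t0 by right.
  have gBJ : good (B, J).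
    split=> /=.
    - split; first by exists t0 => //; case: rA.
        move=> x y [s Fs sx] [t Ft ty].
        have [u Fu [/asboolP[su _] /asboolP[tu _]]] := totF' _ _ Fs Ft.
        exists u => //; case: (svalP u) => -[_ uB _] _ _ _.
        by apply: uB; [apply: su|apply: tu].
      move=> x y [s Fs sx] [t Ft ty].
      have [u Fu [/asboolP[su _] /asboolP[tu _]]] := totF' _ _ Fs Ft.
      exists u => //; case: (svalP u) => ru _ _ _.
      by apply: subringM => //; [apply: su|apply: tu].
    - split.
      + move=> x [t Ft tx]; exists t => //.
        by case: (svalP t) => _ [tJ _ _ _ _] _ _; apply: tJ.
      + by exists t0 => //=; case: iI.
      + move=> x y [s Fs sx] [t Ft ty].
        have [u Fu [/asboolP[_ su] /asboolP[_ tu]]] := totF' _ _ Fs Ft.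
        exists u => //; case: (svalP u) => _ [_ _ uD _ _] _ _.
        by apply: uD; [apply: su|apply: tu].
      + move=> x y [s Fs sx] [t Ft ty].
        have [u Fu [/asboolP[su _] /asboolP[_ tu]]] := totF' _ _ Fs Ft.
        exists u => //; case: (svalP u) => _ [_ _ _ uM _] _ _.
        by apply: uM; [apply: su|apply: tu].
      + by move=> [t Ft t1]; case: (svalP t) => _ [_ _ _ _ /(_ t1)].
    - by move=> a Aa; exists t0.
    - by move=> a Aa; exists t0.
  exists (exist _ _ gBJ) => s Fs; apply/asboolP; split=> x sx /=;
    by exists s => //; left.
Qed.

(** * Chevalley's theorem: the ring of a maximal pair is a valuation ring *)

Section Chevalley.
Variables (B J : set Z).
Hypotheses (rB : subring B) (iJ : proper_ideal_in B J).
Hypothesis maxB : forall B' J', subring B' -> proper_ideal_in B' J' ->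
  B `<=` B' -> J `<=` J' -> B' `<=` B.

Let JB : J `<=` B. Proof. by case: iJ. Qed.
Let J0 : J 0. Proof. by case: iJ. Qed.
Let JD x y : J x -> J y -> J (x + y). Proof. by case: iJ => _ _ + _ _; apply. Qed.
Let JM b x : B b -> J x -> J (b * x). Proof. by case: iJ => _ _ _ + _; apply. Qed.
Let J1 : ~ J 1. Proof. by case: iJ. Qed.
Let JN x : J x -> J (- x).
Proof. by rewrite -mulN1r; apply: JM; apply: subringN => //; case: rB. Qed.

(** If 1 is not in J[z], then J[z] is a proper ideal of B[z], and maximality gives B[z] = B. *)
Lemma maximal_pair_adjoin z : ~ B z -> exists2 q, coefs_in J q & q.[z] = 1.
Proof.
move=> nBz; apply: contrapT => noq; apply: nBz.
suff: adjoin B z `<=` B by apply; apply: mem_adjoin.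
have Bz a : B a -> GRing.comm a z by move=> _; apply: mulrC.
apply: (maxB (J' := [set y | exists2 q, coefs_in J q & y = q.[z]])).
- exact: subring_adjoin.
- split.
  + by move=> _ [q Jq ->]; exists q => // i; apply: JB.
  + by exists 0; rewrite ?horner0 // => i; rewrite coef0.
  + move=> _ _ [p Jp ->] [q Jq ->]; exists (p + q); rewrite ?hornerD // => i.
    by rewrite coefD; apply: JD.
  + move=> _ _ [p Bp ->] [q Jq ->]; exists (p * q); rewrite ?hornerM // => i.
    by rewrite coefM; apply: (proper_ideal_sum _ iJ) => j _; apply: JM.
  + by case=> q Jq q1; apply: noq; exists q.
- exact: sub_adjoin.
- by move=> x Jx; exists x%:P; rewrite ?hornerC //; apply: coefs_inC.
Qed.

(** Otherwise u = 1 - d satisfies q(u^-1) = 1 with [q] over [J]. Multiplying by a large power of [u]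
    puts that power in [J], although every power of [u] is 1 modulo [J]. *)
Lemma maximal_pair_unit d : J d -> B (1 - d)^-1.
Proof.
move=> Jd; set u := 1 - d; apply: contrapT => /maximal_pair_adjoin[q Jq qu].
have Bu : B u by case: (rB) => B1 BB _; apply: BB => //; apply: JB.
have u0 : u != 0.
  apply/eqP => u0; apply: J1.
  by have /eqP := u0; rewrite /u subr_eq0 => /eqP ->.
have un n : J (1 - u ^+ n).
  elim: n => [|n IH]; first by rewrite expr0 subrr.
  have -> : 1 - u ^+ n.+1 = (1 - u ^+ n) + u ^+ n * d.
    by rewrite exprSr /u; ring.
  by apply: JD => //; apply: JM => //; apply: subringX.
have: J (u ^+ size q * q.[u^-1]).
  rewrite horner_coef mulr_sumr; apply: (proper_ideal_sum _ iJ) => i _.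
  rewrite mulrCA mulrC; apply: JM => //.
  by rewrite exprVn -expfB ?ltn_ord //; apply: subringX.
rewrite qu mulr1 => Ju; apply: J1; rewrite -(subrK (u ^+ size q) 1).
exact: JD.
Qed.

(* From z^-l = 1 - (lower powers of z^-1) one gets z^l as a combination of
   lower powers of z, which lowers the degree of a relation p.[z] = 1. *)
Lemma maximal_pair_relations n z p q : (size p + size q <= n)%N -> z != 0 ->
  coefs_in J p -> coefs_in J q -> p.[z] = 1 -> q.[z^-1] = 1 -> False.
Proof.
elim: n z p q => [|n IH] z p q.
  rewrite leqn0 addn_eq0 => /andP[/eqP p0 _] _ _ _.
  move/eqP: p0; rewrite size_poly_eq0 => /eqP ->.
  by rewrite horner0 => /esym/eqP; rewrite oner_eq0.
move=> les z0 Jp Jq pz qz.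
(* Passing from z to z^-1 exchanges the two relations. *)
wlog leqp : z p q les z0 Jp Jq pz qz / (size q <= size p)%N.
  move=> W; case: (leqP (size q) (size p)); first exact: (W z).
  move=> /ltnW; apply: (W z^-1); rewrite ?invrK ?invr_eq0 //.
  by rewrite addnC.
have q0 : q != 0.
  by apply: contra_eq_neq qz => ->; rewrite horner0 eq_sym oner_eq0.
have szq : size q = (size q).-1.+1 by rewrite prednK // size_poly_gt0.
have szp : size p = (size p).-1.+1 by rewrite prednK // (leq_trans _ leqp) // szq.
set l := (size q).-1 in szq; set k := (size p).-1 in szp.
have lk : (l <= k)%N by rewrite -ltnS -szq -szp.
pose u := 1 - q`_0.
have Bu : B u^-1 by apply: maximal_pair_unit.
have u0 : u != 0.
  apply/eqP => /eqP; rewrite /u subr_eq0 => /eqP u0.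
  by apply: J1; rewrite u0.
pose r := \poly_(j < l) (u^-1 * q`_(l - j)).
have Jr : coefs_in J r by move=> i; rewrite coef_poly; case: ifP => // _; apply: JM.
have rz : r.[z] = z ^+ l.
  have : z ^+ l * u = \sum_(i < l) q`_i.+1 * z ^+ (l - i.+1).
    rewrite /u mulrBr mulr1 -{1}[z ^+ l]mulr1 -qz horner_coef szq.
    rewrite big_ord_recl expr0 mulr1 mulrDr addrC addKr mulr_sumr.
    apply: eq_bigr => i _; rewrite mulrCA exprVn -expfB_cond //.
    by rewrite (negPf z0) ltn_ord.
  move=> /(canRL (mulfK u0)) ->; rewrite horner_poly mulr_suml.
  rewrite [RHS](reindex_inj rev_ord_inj) /=; apply: eq_bigr => i _.
  have il : (i < l)%N by apply: ltn_ord.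
  by rewrite subnSK // subKn 1?ltnW //; ring.
have szr : (size ('X^(k - l) * r)%R <= k)%N.
  have [->|r0] := eqVneq r 0; first by rewrite mulr0 size_poly0.
  rewrite mulrC size_mulXn // -[X in (_ <= X)%N](subnK lk) leq_add2l.
  exact: size_poly.
(* The top term of [p] is replaced by its coefficient times z^(k-l) r(z), which has the same value
   at z and smaller degree. *)
pose p' := (p - p`_k *: 'X^k) + p`_k *: ('X^(k - l) * r).
have szp' : (size p' <= k)%N.
  apply: (leq_trans (size_polyD _ _)); rewrite geq_max.
  apply/andP; split; last exact: leq_trans (size_scale_leq _ _) _.
  apply/leq_sizeP => j; rewrite leq_eqVlt => /orP[/eqP <-|kj].
    by rewrite coefB coefZ coefXn eqxx mulr1 subrr.
  rewrite coefB coefZ coefXn gtn_eqF // mulr0 subr0.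
  by rewrite nth_default // szp.
apply: (IH z p' q) => //.
- rewrite -ltnS; apply: leq_trans les.
  by rewrite szp addSn ltnS leq_add2r.
- move=> i; rewrite coefD coefB !coefZ; apply: JD.
    apply: JD => //; apply: JN; rewrite coefXn; case: eqP; last by rewrite mulr0.
    by rewrite mulr1.
  rewrite coefXnM; case: ltnP; first by rewrite mulr0.
  by move=> _; apply: JM => //; apply: JB.
- rewrite !hornerD hornerN !hornerZ hornerM !hornerXn rz -exprD subnK //.
  by rewrite subrK.
Qed.

End Chevalley.

(** The ring of a maximal pair above (A, I) works: if it missed both z and z^-1, both would satisfy
    relations over [J], which [maximal_pair_relations] excludes. An element of [J] with inverse in
    the ring would put 1 in [J]. *)
Lemma valuation_ring_dominating A I : subring A -> proper_ideal_in A I ->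
  exists V, [/\ valuation_ring V, A `<=` V & I `<=` nonunits V].
Proof.
move=> rA iI; have [B [J [rB iJ AB IJ maxB]]] := maximal_ideal_pair rA iI.
exists B; split=> //.
- split=> // z; apply: contrapT => /not_orP[nz nz'].
  have z0 : z != 0 by apply/eqP => z0; apply: nz; rewrite z0; apply: subring0.
  have [p Jp pz] := maximal_pair_adjoin rB iJ maxB nz.
  have [q Jq qz] := maximal_pair_adjoin rB iJ maxB nz'.
  exact: (maximal_pair_relations rB iJ maxB (leqnn _) z0 Jp Jq pz qz).
- move=> x /IJ Jx; case: (iJ) => JB _ _ JM J1; split; first exact: JB.
  have [->|x0] := eqVneq x 0; [by left|right => Bx; apply: J1].
  by rewrite -(mulVf x0); apply: JM.
Qed.

End ValuationRings.

(** * Valuation rings with finite residues on a subring *)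

Section Places.
Context {Z : fieldType}.
Implicit Types (A I V : set Z) (a b x y z : Z) (f p q : {poly Z}).

Section ValuationRing.
Variable V : set Z.
Hypothesis vV : valuation_ring V.

Let rV : subring V. Proof. by case: vV. Qed.

Lemma nonunits_sub : nonunits V `<=` V. Proof. by move=> x []. Qed.

Lemma nonunits0 : nonunits V 0.
Proof. by split; [apply: subring0|left]. Qed.

Lemma nonunitsM v x : V v -> nonunits V x -> nonunits V (v * x).
Proof.
move=> Vv [Vx ux]; split; first exact: subringM.
have [->|vx0] := eqVneq (v * x) 0; [by left|right => Vvx].
move: vx0; rewrite mulf_eq0 negb_or => /andP[v0 x0].
case: ux => [x00|]; first by rewrite x00 eqxx in x0.
apply; have -> : x^-1 = v * (v * x)^-1 by field; rewrite x0 v0.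
exact: subringM.
Qed.

(** One of x / y and y / x lies in [V], so x + y is a [V]-multiple of x or of y. *)
Lemma nonunitsD x y : nonunits V x -> nonunits V y -> nonunits V (x + y).
Proof.
move=> mx my.
have [->|x0] := eqVneq x 0; first by rewrite add0r.
have [->|y0] := eqVneq y 0; first by rewrite addr0.
have V1 : V 1 by case: rV.
case: (vV) => _ /(_ (x / y))[Vxy|].
  have -> : x + y = (x / y + 1) * y by field.
  by apply: nonunitsM => //; apply: subringD.
rewrite invf_div => Vyx; have -> : x + y = (y / x + 1) * x by field.
by apply: nonunitsM => //; apply: subringD.
Qed.

Lemma nonunitsN x : nonunits V x -> nonunits V (- x).
Proof.
by rewrite -mulN1r; apply: nonunitsM; apply: subringN => //; case: rV.
Qed.

Lemma nonunitsB x y : nonunits V x -> nonunits V y -> nonunits V (x - y).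
Proof. by move=> mx my; apply: nonunitsD => //; apply: nonunitsN. Qed.

Lemma nonunits_sum (T : Type) (s : seq T) (P : pred T) (F : T -> Z) :
  (forall i, P i -> nonunits V (F i)) ->
  nonunits V (\sum_(i <- s | P i) F i).
Proof.
by move=> mF; apply: (big_ind (nonunits V)) => //;
  [apply: nonunits0|apply: nonunitsD].
Qed.

Lemma nonunits1 : ~ nonunits V 1.
Proof.
by case=> V1 [/eqP|]; [rewrite oner_eq0|rewrite invr1; apply].
Qed.

Lemma unit_inv x : V x -> ~ nonunits V x -> x != 0 /\ V x^-1.
Proof.
move=> Vx nmx; split.
  by apply: contra_notN nmx => /eqP ->; apply: nonunits0.
by apply: contrapT => nVx; apply: nmx; split=> //; right.
Qed.

Lemma inv_unit x : x != 0 -> V x^-1 -> ~ nonunits V x.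
Proof. by move=> x0 Vx [_ [/eqP|//]]; rewrite (negPf x0). Qed.

Lemma nonunits_prime x y : V x -> V y -> nonunits V (x * y) ->
  nonunits V x \/ nonunits V y.
Proof.
move=> Vx Vy mxy; apply/or_asboolP; apply/negP => /negP.
rewrite negb_or => /andP[/asboolPn /(unit_inv Vx)[x0 Vx'] /asboolPn nmy].
apply: nmy; have -> : y = x^-1 * (x * y) by field.
exact: nonunitsM.
Qed.

Lemma nonunits_inv x : ~ V x -> nonunits V x^-1.
Proof.
move=> nVx; split; last by right; rewrite invrK.
by case: vV => _ /(_ x)[].
Qed.

(** Valuation rings are integrally closed: if x is not in [V], then x^-1 is a nonunit, and dividing
    f(x) = 0 by x^n, with n the degree of [f], makes the leading coefficient a nonunit. *)
Lemma valuation_ring_integral f x : coefs_in V f -> f != 0 ->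
  V (lead_coef f)^-1 -> f.[x] = 0 -> V x.
Proof.
move=> Vf f0 Vl fx; apply: contrapT => nVx.
have mx : nonunits V x^-1 by apply: nonunits_inv.
have x0 : x != 0 by apply: contra_not_neq nVx => ->; apply: subring0.
apply: (inv_unit _ Vl); first by rewrite lead_coef_eq0.
have szf : size f = (size f).-1.+1 by rewrite prednK // size_poly_gt0.
set n := (size f).-1 in szf.
have : \sum_(i < n) f`_i * (x^-1) ^+ (n - i) + lead_coef f = 0.
  transitivity (f.[x] * x^-1 ^+ n); last by rewrite fx mul0r.
  rewrite horner_coef szf big_ord_recr /= mulrDl mulr_suml; congr (_ + _).
    apply: eq_bigr => i _; rewrite -mulrA !exprVn.
    by rewrite expfB_cond ?(negPf x0) ?invf_div ?add0n 1?ltnW.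
  by rewrite -mulrA -exprMn divff // expr1n mulr1.
rewrite addrC => /(canRL (addrK _)) ->; rewrite sub0r; apply: nonunitsN.
apply: nonunits_sum => i _; apply: nonunitsM; first exact: Vf.
have : (0 < n - i)%N by rewrite subn_gt0.
case: (n - i)%N => // k _; rewrite exprSr; apply: nonunitsM => //.
by apply: subringX => //; apply: nonunits_sub.
Qed.

End ValuationRing.

(** Finiteness concerns only the image of [A] in the residue field of [V], which itself may be
    infinite. Representatives are taken inside [A], which [finite_residueI] shows to be no
    restriction. *)
Definition finite_residue V A : Prop := exists s : seq Z,
  forall x, A x -> exists y, [/\ y \in s, A y & nonunits V (x - y)].

Lemma finite_residueI V A (s : seq Z) : valuation_ring V ->
  (forall x, A x -> exists2 y, y \in s & nonunits V (x - y)) ->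
  finite_residue V A.
Proof.
move=> vV hs.
have /choice[g hg] y : exists z, (exists2 x, A x & nonunits V (x - y)) ->
    A z /\ nonunits V (z - y).
  by have [[x Ax mx]|no] := pselect (exists2 x, A x & nonunits V (x - y));
    [exists x|exists 0].
exists (map g s) => x Ax; have [y ys mxy] := hs x Ax.
have [Ag mg] := hg y (ex_intro2 _ _ x Ax mxy).
exists (g y); split=> //; first exact: map_f.
have -> : x - g y = (x - y) - (g y - y) by ring.
exact: nonunitsB.
Qed.

Section FiniteResidue.
Variables (V A : set Z).
Hypotheses (vV : valuation_ring V) (rA : subring A) (AV : A `<=` V).
Hypothesis fA : finite_residue V A.

(** Two powers of [a] have the same residue by the pigeonhole principle, so a positive power of [a]
    has residue 1. The inverse thus found lies in [A], and not only in [V]. *)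
Lemma finite_residue_inv a : A a -> a != 0 -> V a^-1 ->
  exists2 b, A b & nonunits V (b * a - 1).
Proof.
move=> Aa a0 Va; have [s hs] := fA.
have /choice[g hg] n : exists y, y \in s /\ nonunits V (a ^+ n - y).
  have [|y [ys _ my]] := hs (a ^+ n); first exact: subringX.
  by exists y.
have : ~~ uniq (map g (iota 0 (size s).+1)).
  apply/negP => /(@uniq_leq_size _ _ s).
  rewrite size_map size_iota ltnn => abs; suff: false by [].
  by apply: abs => _ /mapP[n _ ->]; case: (hg n).
move=> /(uniqPn 0)[i [j [ij]]]; rewrite size_map size_iota => js.
rewrite !(nth_map 0%N) ?size_iota ?(ltn_trans ij) // !nth_iota ?(ltn_trans ij) //.
rewrite !add0n => gij; exists (a ^+ (j - i.+1)); first exact: subringX.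
rewrite -exprSr subnSK //.
have mij : nonunits V (a ^+ i * (a ^+ (j - i) - 1)).
  rewrite mulrBr mulr1 -exprD subnKC 1?ltnW //.
  have -> : a ^+ j - a ^+ i = (a ^+ j - g j) - (a ^+ i - g i) by rewrite gij; ring.
  by apply: nonunitsB => //; [case: (hg j)|case: (hg i)].
have Vaj : V (a ^+ (j - i) - 1).
  by case: (rA) => A1 AB _; apply/AV/AB => //; apply: subringX.
have [|mai|//] := nonunits_prime vV _ Vaj mij; first by apply: AV; apply: subringX.
suff: ~ nonunits V (a ^+ i) by [].
apply: inv_unit; first exact: expf_neq0.
by rewrite -exprVn; apply: subringX => //; case: vV.
Qed.

(** Modulo nonunits x is a root of [f], whose leading coefficient is invertible there. Hence every
    polynomial in x reduces to degree below that of [f], and such polynomials have finitely many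
    residues. *)
Lemma finite_residue_adjoin x f : V x -> coefs_in A f -> f != 0 ->
  V (lead_coef f)^-1 -> nonunits V f.[x] -> finite_residue V (adjoin A x).
Proof.
move=> Vx Af f0 Vl mf; have rV : subring V by case: vV.
have l0 : lead_coef f != 0 by rewrite lead_coef_eq0.
have [b Ab] := finite_residue_inv (Af _ : A (lead_coef f)) l0 Vl.
rewrite /lead_coef; set n := (size f).-1 => mb.
have szf : size f = n.+1 by rewrite prednK // size_poly_gt0.
have red p : coefs_in A p ->
    exists r, coefs_in A r /\ nonunits V (p.[x] - \sum_(i < n) r`_i * x ^+ i).
  elim/poly_ind: p => [_|p c IH Ap].
    exists 0; split; first by move=> i; rewrite coef0; apply: subring0.
    rewrite horner0 sub0r; apply: nonunitsN => //; apply: nonunits_sum => // i _.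
    by rewrite coef0 mul0r; apply: nonunits0.
  have [|r [Ar mr]] := IH.
    by move=> i; have := Ap i.+1; rewrite coefD coefMX coefC /= addr0.
  have Ac : A c by have := Ap 0%N; rewrite coefD coefMX coefC /= add0r.
  pose s := (\poly_(i < n) r`_i) * 'X + c%:P.
  have As : coefs_in A s.
    move=> i; rewrite coefD coefMX coefC coef_poly; apply: subringD => //.
      by case: ifP => _; [apply: subring0|case: ifP => _ //; apply: subring0].
    by case: eqP => // _; apply: subring0.
  have sx : s.[x] = \sum_(i < n.+1) s`_i * x ^+ i.
    apply: horner_coef_wide; rewrite /s; apply: leq_trans (size_polyD _ _) _.
    rewrite geq_max (leq_trans (size_polyC_leq1 _)) // andbT.
    apply: leq_trans (size_polyMleq _ _) _.
    by rewrite size_polyX addn2 /= ltnS size_poly.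
  (* As [b] inverts the leading coefficient of [f] modulo nonunits, the term of degree n cancels up
     to a nonunit. *)
  exists (s - (s`_n * b) *: f); split.
    move=> i; rewrite coefB coefZ; case: (rA) => _ AB AM.
    by apply: AB; [apply: As|apply: (AM _ _ _ (Af i)); apply: AM; first apply: As].
  have -> : (p * 'X + c%:P).[x] - \sum_(i < n) (s - (s`_n * b) *: f)`_i * x ^+ i
    = x * (p.[x] - \sum_(i < n) r`_i * x ^+ i) - s`_n * x ^+ n * (b * f`_n - 1)
      + s`_n * b * f.[x].
    have fx : f.[x] = \sum_(i < n) f`_i * x ^+ i + f`_n * x ^+ n.
      by rewrite horner_coef szf big_ord_recr.
    have -> : \sum_(i < n) (s - (s`_n * b) *: f)`_i * x ^+ i =
       (s.[x] - s`_n * x ^+ n) - s`_n * b * (f.[x] - f`_n * x ^+ n).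
      rewrite sx fx big_ord_recr /= !addrK mulr_sumr -sumrB.
      by apply: eq_bigr => i _; rewrite coefB coefZ; ring.
    have -> : s.[x] = x * (\sum_(i < n) r`_i * x ^+ i) + c.
      by rewrite hornerMXaddC horner_poly mulrC.
    by rewrite hornerMXaddC; ring.
  apply: nonunitsD => //; first apply: nonunitsB => //.
  - exact: nonunitsM.
  - by apply: nonunitsM => //; apply: subringM => //; [apply/AV/As|apply: subringX].
  - by apply: nonunitsM => //; apply: subringM => //; [apply/AV/As|apply: AV].
have [s hs] := fA.
have fin k : exists F : seq Z, forall c : nat -> Z, (forall i, A (c i)) ->
    exists2 y, y \in F & nonunits V (\sum_(i < k) c i * x ^+ i - y).
  elim: k => [|k [F hF]].
    by exists [:: 0] => c _; exists 0; rewrite ?inE // big_ord0 subrr; apply: nonunits0.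
  exists [seq y + z * x ^+ k | y <- F, z <- s] => c Ac.
  have [y yF my] := hF c Ac; have [z [zs _ mz]] := hs (c k) (Ac k).
  exists (y + z * x ^+ k); first exact: allpairs_f.
  rewrite big_ord_recr /=.
  have -> : \sum_(i < k) c i * x ^+ i + c k * x ^+ k - (y + z * x ^+ k) =
    (\sum_(i < k) c i * x ^+ i - y) + x ^+ k * (c k - z) by ring.
  by apply: nonunitsD => //; apply: nonunitsM => //; apply: subringX.
have [F hF] := fin n; apply: (@finite_residueI _ _ F) => // _ [p Ap ->].
have [r [Ar mr]] := red p Ap; have [y yF my] := hF _ Ar.
exists y => //.
have -> : p.[x] - y = (p.[x] - \sum_(i < n) r`_i * x ^+ i)
   + (\sum_(i < n) r`_i * x ^+ i - y) by ring.
exact: nonunitsD.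
Qed.

End FiniteResidue.
End Places.

(** * Existence of finite places on finitely generated subrings *)

Section PlaceExtension.
Context {Z : fieldType}.
Implicit Types (A V : set Z) (a x t : Z) (f p q : {poly Z}).

(** The prescribed unit [a] is what carries the induction: it is used to make leading coefficients
    invertible when elements are adjoined. *)
Definition has_finite_places A : Prop := forall a, A a -> a != 0 ->
  exists V, [/\ valuation_ring V, A `<=` V, V a^-1 & finite_residue V A].

Definition integers_in : set Z := [set z | exists n : int, z = n%:~R].

Lemma subring_integers : subring integers_in.
Proof.
split; first by exists 1.
- by move=> _ _ [m ->] [n ->]; exists (m - n); rewrite rmorphB.
- by move=> _ _ [m ->] [n ->]; exists (m * n); rewrite rmorphM.
Qed.

(** In positive characteristic take the characteristic itself, which is 0 in [Z]. In characteristic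
    0 take any prime larger than |n|. *)
Lemma prime_not_unit (n : int) : n%:~R != 0 :> Z -> exists p : nat,
  [/\ prime p, ~~ (p %| `|n|)%N & forall m : int, p%:R * m%:~R != 1 :> Z].
Proof.
move=> n0; have [[l chl]|nch] := pselect (exists l, l \in [pchar Z]).
  exists l; split; first exact: pcharf_prime chl.
    apply: contra_neqN n0 => ln; apply/eqP.
    case: n ln => k /=; rewrite ?NegzE ?rmorphN /= ?oppr_eq0 => lk.
      by rewrite -(dvdn_pcharf chl).
    by rewrite -(dvdn_pcharf chl).
  by move=> m; rewrite (pcharf0 chl) mul0r eq_sym oner_eq0.
have ch0 : [pchar Z] =i pred0.
  by move=> l; apply/negbTE/negP => chl; apply: nch; exists l.
have [p pn pp] := prime_above `|n|%N; exists p; split=> //.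
  have n1 : (0 < `|n|)%N.
    by rewrite absz_gt0; apply: contra_neq n0 => ->.
  by rewrite gtnNdvd.
move=> m; apply/eqP => /(congr1 (fun z => z - 1)); rewrite subrr.
have -> : p%:R * m%:~R - 1 = (p%:Z * m - 1)%:~R :> Z.
  by rewrite rmorphB rmorphM /=.
move=> /eqP; set k := _ - 1; have -> : (k%:~R == 0 :> Z) = (k == 0).
  have /pcharf0P ch0' := ch0.
  by case: (k) => j; rewrite ?NegzE ?rmorphN /= ?oppr_eq0 ch0'.
rewrite subr_eq0 => /eqP/(congr1 absz); rewrite abszM /= => pm.
have : (p %| 1)%N by rewrite -pm dvdn_mulr.
by rewrite dvdn1 => /eqP p1; rewrite p1 in pp.
Qed.

(** A valuation ring dominating the ideal generated by a prime p not dividing n: Bezout's identity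
    keeps n a unit, and 0, ..., p - 1 represent all residues. *)
Lemma integers_finite_places : has_finite_places integers_in.
Proof.
move=> _ [n ->] n0; have [p [pp pn p1]] := prime_not_unit n0.
pose I : set Z := [set z | exists m : int, z = p%:R * m%:~R].
have iI : proper_ideal_in integers_in I.
  split.
  - by move=> _ [m ->]; exists (p%:Z * m); rewrite rmorphM.
  - by exists 0; rewrite mulr0.
  - by move=> _ _ [m ->] [k ->]; exists (m + k); rewrite rmorphD mulrDr.
  - by move=> _ _ [m ->] [k ->]; exists (m * k); rewrite rmorphM mulrCA.
  - by case=> m /esym/eqP; rewrite (negPf (p1 m)).
have [V [vV AV IV]] := valuation_ring_dominating subring_integers iI.
have mp : nonunits V p%:R by apply: IV; exists 1; rewrite mulr1.
exists V; split=> //.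
  have Vn : V n%:~R by apply: AV; exists n.
  suff: ~ nonunits V n%:~R by case/(unit_inv vV Vn).
  move=> mn; apply: (nonunits1 (V := V)).
  have [[u v] /= uv] : exists uv : int * int, uv.1 * p%:Z + uv.2 * n = 1.
    have [u [v uv]] := Bezoutz p%:Z n; exists (u, v); rewrite /= uv.
    have cpn : coprime p `|n| by rewrite prime_coprime.
    by rewrite /gcdz /= (eqP cpn).
  have -> : 1 = u%:~R * p%:R + v%:~R * n%:~R :> Z.
    by rewrite -[p%:R]/(p%:Z%:~R) -!rmorphM -rmorphD uv.
  by apply: nonunitsD => //; apply: nonunitsM => //; apply: AV; [exists u|exists v].
apply: (@finite_residueI _ _ _ [seq i%:R | i <- iota 0 p]) => // _ [m ->].
have p0 : p%:Z != 0 by rewrite -lt0n prime_gt0.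
have := modz_ge0 m p0; have := ltz_pmod m (_ : 0 < p%:Z)%R.
rewrite ltz_nat prime_gt0 // => /(_ isT).
case E : (m %% p)%Z => [k|//] kp _; exists k%:R.
  by apply/mapP; exists k => //; rewrite mem_iota.
rewrite {1}(divz_eq m p) E rmorphD /= addrK rmorphM /=.
by apply: nonunitsM => //; apply: AV; eexists.
Qed.

(* For c = q.[t], a place at which 1 + t * c is not a unit makes c a unit, and
   the residue of t algebraic because the leading coefficient of q is a unit. *)
Lemma adjoin_finite_places A t : subring A ->
  (forall f, coefs_in A f -> f.[t] = 0 -> f = 0) ->
  has_finite_places A -> has_finite_places (adjoin A t).
Proof.
move=> rA trt JA _ [q Aq ->] c0; set c := q.[t] in c0 *.
have q0 : q != 0 by apply: contra_neq c0 => q0; rewrite /c q0 horner0.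
have l0 : lead_coef q != 0 by rewrite lead_coef_eq0.
have [V [vV AV Vl fV]] := JA _ (Aq _) l0.
have rAt : subring (adjoin A t) by apply: subring_adjoin => // a _; apply: mulrC.
pose P : set Z := A `&` nonunits V.
pose h := 1 + q * 'X.
have Ah : coefs_in A h.
  apply: coefs_inD => //; first by apply: coefs_inC; [apply: subring0|case: rA].
  by apply: coefs_inM => //; apply: coefs_inX.
have szh : size h = (size q).+1.
  rewrite /h addrC size_polyDl size_mulX // size_poly1 ltnS.
  by rewrite size_poly_gt0.
have lh : lead_coef h = lead_coef q.
  rewrite /h addrC lead_coefDl ?lead_coefMX // size_mulX // size_poly1 ltnS.
  by rewrite size_poly_gt0.
have ht : h.[t] = 1 + t * c.
  by rewrite hornerD hornerMX hornerC mulrC.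
pose I : set Z := [set z | exists2 pg : {poly Z} * {poly Z},
  coefs_in P pg.1 /\ coefs_in A pg.2 & z = pg.1.[t] + pg.2.[t] * h.[t]].
have P0 : P 0 by split; [apply: subring0|apply: nonunits0].
have Ac (a : Z) : A a -> coefs_in A a%:P by move=> Aa; apply: coefs_inC => //; apply: subring0.
have iI : proper_ideal_in (adjoin A t) I.
  split.
  - move=> _ [[p g] [/= Pp Ag] ->]; apply: subringD => //.
      by exists p => // i; case: (Pp i).
    by apply: subringM => //; [exists g|exists h].
  - exists (0, 0); rewrite /= ?horner0 ?mul0r ?addr0 //.
    by split=> i; rewrite coef0 //; apply: subring0.
  - move=> _ _ [[p g] [/= Pp Ag] ->] [[p' g'] [/= Pp' Ag'] ->].
    exists (p + p', g + g'); rewrite /= ?hornerD; last by ring.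
    split; last exact: coefs_inD.
    move=> i; rewrite coefD; have [a b] := Pp i; have [a' b'] := Pp' i.
    by split; [apply: subringD|apply: nonunitsD].
  - move=> _ _ [r Ar ->] [[p g] [/= Pp Ag] ->].
    exists (r * p, r * g); rewrite /= ?hornerM; last by ring.
    split; last exact: coefs_inM.
    move=> i; rewrite coefM; split.
      by apply: subring_sum => // j _; apply: subringM => //; case: (Pp (i - j)%N).
    apply: nonunits_sum => // j _; apply: nonunitsM => //; first by apply: AV.
    by case: (Pp (i - j)%N).
  - case=> -[p g] [/= Pp Ag]; rewrite -hornerM -hornerD => one.
    (* As [t] is transcendental over [A], a relation between values at [t] is an identity of
       polynomials. *)
    have pgh : p + g * h = 1.
      apply/eqP; rewrite -subr_eq0; apply/eqP/trt.
        apply: coefs_inB => //; last by apply: Ac; case: rA.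
        by apply: coefs_inD => //; [move=> i; case: (Pp i)|apply: coefs_inM].
      by rewrite hornerD hornerN -one hornerC subrr.
    have [ng|] := pselect (forall i, nonunits V g`_i).
      apply: (nonunits1 (V := V)).
      have -> : 1 = p`_0 + g`_0 * h`_0.
        have : (p + g * h)`_0 = 1 by rewrite pgh coef1.
        by rewrite coefD coefM big_ord1.
      apply: nonunitsD => //; first by case: (Pp 0%N).
      by rewrite mulrC; apply: nonunitsM => //; apply: AV.
    move=> /existsNP[i0 gi0].
    (* Let [j] be the last index with a unit coefficient in [g]. In degree j + deg h, where deg h =
       [size q], the identity p + g h = 1 has coefficient 0, yet modulo nonunits it reduces to the
       unit g_j times the leading coefficient of [q]. *)
    pose Q i := `[< ~ nonunits V g`_i >].
    have exQ : exists i, Q i by exists i0; apply/asboolP.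
    have Qle i : Q i -> (i <= size g)%N.
      move=> /asboolP Qi; rewrite leqNgt; apply/negP => /ltnW szg; apply: Qi.
      by rewrite nth_default //; apply: nonunits0.
    case: (ex_maxnP exQ Qle) => j /asboolP nj maxj.
    have {}maxj i : (j < i)%N -> nonunits V g`_i.
      move=> ji; apply: contrapT => ni; have /maxj : Q i by apply/asboolP.
      by rewrite leqNgt ji.
    have d0 : (0 < size q)%N by rewrite size_poly_gt0.
    have hd : h`_(size q) = lead_coef q by rewrite -lh lead_coefE szh.
    have : (p + g * h)`_(j + size q) = 0.
      by rewrite pgh coef1 addn_eq0 (gtn_eqF d0) andbF.
    rewrite coefD coefM.
    have jlt : (j < (j + size q).+1)%N by rewrite ltnS leq_addr.
    rewrite (bigD1 (Ordinal jlt)) //= addKn hd.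
    set S := \sum_(i < _ | _) _; move=> e.
    have : nonunits V (g`_j * lead_coef q).
      have -> : g`_j * lead_coef q = - (p`_(j + size q) + S).
        by apply/eqP; rewrite -addr_eq0 addrC -addrA [S + _]addrC e.
      apply: nonunitsN => //; apply: nonunitsD => //; first by case: (Pp (j + size q)%N).
      apply: nonunits_sum => // i ij; have [ltij|ltji|eij] := ltngtP i j.
      - rewrite [h`__]nth_default ?mulr0; first exact: nonunits0.
        by rewrite szh ltn_subRL ltn_add2r.
      - by rewrite mulrC; apply: nonunitsM; [|apply: AV|apply: maxj].
      - by case/eqP: ij; apply: val_inj.
    have Vq : V (lead_coef q) by apply: AV; apply: Aq.
    by case/(nonunits_prime vV (AV _ (Ag j)) Vq) => //; apply: inv_unit.
have [V' [vV' AV' IV']] := valuation_ring_dominating rAt iI.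
have PV' : P `<=` nonunits V'.
  move=> x Px; apply: IV'; exists (x%:P, 0) => /=.
    by split=> i; [rewrite coefC; case: eqP|rewrite coef0; apply: subring0].
  by rewrite hornerC horner0 mul0r addr0.
have mh : nonunits V' h.[t].
  apply: IV'; exists (0, 1); rewrite /= ?horner0 ?hornerC ?mul1r ?add0r //.
  by split; [move=> i; rewrite coef0|apply: Ac; case: rA].
have V't : V' t by apply: AV'; apply: mem_adjoin.
have V'c : V' c by apply: AV'; exists q.
have AV'' : A `<=` V' by apply: subset_trans AV'; apply: sub_adjoin.
have fV'A : finite_residue V' A.
  have [s hs] := fV; exists s => x Ax; have [y [ys Ay mxy]] := hs x Ax.
  exists y; split=> //; apply: PV'; split=> //.
  by case: rA => _ AB _; apply: AB.
(* The inverse modulo nonunits of [V] is found in [A], and [P] stays inside the nonunits of [V'];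
   hence invertibility passes from [V] to [V']. *)
have V'l : V' (lead_coef h)^-1.
  have [b Ab mb] := finite_residue_inv vV rA AV fV (Aq _) l0 Vl.
  have ml : nonunits V' (b * lead_coef q - 1).
    apply: PV'; split=> //; case: rA => A1 AB AM; apply: AB => //.
    exact: (AM _ _ _ (Aq _)).
  have V'q : V' (lead_coef q) by apply: AV''; apply: Aq.
  rewrite lh; suff: ~ nonunits V' (lead_coef q) by case/(unit_inv vV' V'q).
  move=> mq; apply: (nonunits1 (V := V')).
  have -> : 1 = b * lead_coef q - (b * lead_coef q - 1) by ring.
  by apply: nonunitsB => //; apply: nonunitsM => //; apply: AV''.
exists V'; split=> //.
  suff: ~ nonunits V' c by case/(unit_inv vV' V'c).
  move=> mc; apply: (nonunits1 (V := V')).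
  have -> : 1 = h.[t] - t * c by rewrite ht; ring.
  by apply: nonunitsB => //; apply: nonunitsM.
apply: (finite_residue_adjoin vV' rA AV'' fV'A V't Ah) => //.
by rewrite -size_poly_gt0 szh.
Qed.

Definition algebraic_in A x : Prop :=
  exists f, [/\ coefs_in A f, f != 0 & f.[x] = 0].

(** Starting from the integers, adjoin each listed element that is transcendental over the ring
    built so far. *)
Lemma algebraic_subring (X : seq Z) : exists A, [/\ subring A,
  has_finite_places A & forall x, x \in X -> algebraic_in A x].
Proof.
elim: X => [|x X [A [rA JA algA]]].
  exists integers_in; split=> //; [exact: subring_integers|].
  exact: integers_finite_places.
have [[f [Af f0 fx]]|trx] := pselect (algebraic_in A x).
  exists A; split=> // y; rewrite inE => /orP[/eqP ->|]; last exact: algA.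
  by exists f.
have rAx : subring (adjoin A x) by apply: subring_adjoin => // a _; apply: mulrC.
exists (adjoin A x); split=> //.
  apply: adjoin_finite_places => // f Af fx.
  apply/eqP; apply: contrapT => /negP f0; apply: trx; exists f; split=> //.
have sub := sub_adjoin (A := A) x rA.
move=> y; rewrite inE => /orP[/eqP ->|/algA[f [Af f0 fy]]].
  exists ('X - x%:P); rewrite polyXsubC_eq0 hornerXsubC subrr; split=> //.
  apply: coefs_inB => //; first exact: coefs_inX.
  by apply: coefs_inC; [apply: subring0|apply: mem_adjoin].
by exists f; split=> // i; apply: sub.
Qed.

(** Each x in [X] is a root of a polynomial over [A]. A place at which the product of the leading
    coefficients is a unit makes every x integral over [V], and finiteness of residues survives
    adjoining them one at a time. *)
Theorem finite_place (X : seq Z) : exists V A, [/\ valuation_ring V,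
  subring A, A `<=` V, finite_residue V A & forall x, x \in X -> A x].
Proof.
have [A [rA JA algA]] := algebraic_subring X.
(* The element [a] must be fixed before the place is known, so its effect is stated for all [V] in
   which it is invertible. *)
have [a [Aa a0 ha]] : exists a, [/\ A a, a != 0 & forall V, subring V ->
    A `<=` V -> V a^-1 -> forall x, x \in X -> exists f,
    [/\ coefs_in A f, f != 0, V (lead_coef f)^-1 & f.[x] = 0]].
  elim: X algA => [_|x X IH algA].
    by exists 1; split; [case: rA|rewrite oner_eq0|].
  have [|a [Aa a0 ha]] := IH.
    by move=> y yX; apply: algA; rewrite inE yX orbT.
  have [f [Af f0 fx]] := algA x (mem_head _ _).
  have l0 : lead_coef f != 0 by rewrite lead_coef_eq0.
  exists (lead_coef f * a); split.
  - by apply: subringM => //; apply: Af.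
  - by rewrite mulf_neq0.
  - move=> V rV AV Vla y; rewrite inE => /orP[/eqP ->|].
      exists f; split=> //; have -> : (lead_coef f)^-1 = (lead_coef f * a)^-1 * a.
        by field; rewrite a0 l0.
      by apply: subringM => //; apply: AV.
    apply: ha => //; have -> : a^-1 = (lead_coef f * a)^-1 * lead_coef f.
      by field; rewrite a0 l0.
    by apply: subringM => //; apply: AV; apply: Af.
have [V [vV AV Va fV]] := JA a Aa a0; have rV : subring V by case: vV.
exists V; have {}ha := ha V rV AV Va.
suff [A' [rA' AA' A'V fA' XA']] : exists A', [/\ subring A', A `<=` A', A' `<=` V,
  finite_residue V A' & forall x, x \in X -> A' x] by exists A'; split.
elim: X {algA} ha => [_|x X IH ha]; first by exists A; split.
have [|A' [rA' AA' A'V fA' XA']] := IH.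
  by move=> y yX; apply: ha; rewrite inE yX orbT.
have [f [Af f0 Vl fx]] := ha x (mem_head _ _).
have A'f : coefs_in A' f by move=> i; apply: AA'.
have Vx : V x.
  by apply: (valuation_ring_integral vV _ f0 Vl fx) => i; apply: A'V.
have sub := sub_adjoin (A := A') x rA'.
exists (adjoin A' x); split.
- by apply: subring_adjoin => // b _; apply: mulrC.
- exact: subset_trans sub.
- exact: adjoin_min.
- apply: (finite_residue_adjoin vV rA' A'V fA' Vx A'f) => //.
  by rewrite fx; apply: nonunits0.
- move=> y; rewrite inE => /orP[/eqP ->|/XA']; first exact: mem_adjoin.
  exact: sub.
Qed.

End PlaceExtension.

(** * Linear algebra over division rings *)

Section DivisionRingLinearAlgebra.
Context {E : unitRingType}.
Hypothesis divE : GRing.field_axiom E.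
Implicit Types (A C W : set E) (x y z : E) (s : seq E).

(** Gaussian elimination, with unknowns on the right of the coefficients because [E] need not be
    commutative. *)
Lemma exists_kernel_vector q l (B : 'I_q -> 'I_l -> E) : (q < l)%N ->
  exists2 v : 'I_l -> E, (exists j, v j != 0) &
    forall i, \sum_j B i j * v j = 0.
Proof.
elim: q l B => [|q IH] [|l] B //= ql.
  by exists (fun=> 1); [exists ord0; apply: oner_neq0|case].
have [[j0 pj0]|nop] := pselect (exists j, B ord_max j != 0); last first.
  have [v v0 hv] := IH l.+1 (fun i => B (widen_ord (leqnSn q) i)) (ltnW ql).
  exists v => // i; case: (unliftP ord_max i) => [k ->|->].
    rewrite -[RHS](hv k); apply: eq_bigr => j _; congr (B _ j * _).
    by apply: val_inj; rewrite /= /bump leqNgt ltn_ord.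
  apply: big1 => j _; have [->|Bj] := eqVneq (B ord_max j) 0.
    by rewrite mul0r.
  by case: nop; exists j.
set p := B ord_max j0 in pj0; have Up : p \is a GRing.unit by apply: divE.
(* The last equation, with pivot [p], eliminates the unknown of index [j0] from the others. *)
pose B' (i : 'I_q) (j : 'I_l) := B (widen_ord (leqnSn q) i) (lift j0 j) -
  B (widen_ord (leqnSn q) i) j0 * p^-1 * B ord_max (lift j0 j).
have [v [j1 v0] hv] := IH l B' ql.
pose u := \sum_j B ord_max (lift j0 j) * v j.
pose w j := if unlift j0 j is Some k then v k else - (p^-1 * u).
have wl k : w (lift j0 k) = v k by rewrite /w liftK.
have w0 : w j0 = - (p^-1 * u) by rewrite /w unlift_none.
have sumw i : \sum_j B i j * w j =
    \sum_j B i (lift j0 j) * v j - B i j0 * p^-1 * u.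
  rewrite (bigD1_ord j0) //= w0 mulrN mulrA addrC; congr (_ - _).
  by apply: eq_bigr => k _; rewrite wl.
exists w; first by exists (lift j0 j1); rewrite wl.
move=> i; rewrite sumw; case: (unliftP ord_max i) => [k ->|->].
  have -> : lift ord_max k = widen_ord (leqnSn q) k.
    by apply: val_inj; rewrite /= /bump leqNgt ltn_ord.
  rewrite -[RHS](hv k) /u mulr_sumr -sumrB; apply: eq_bigr => j _.
  by rewrite /B' mulrBl !mulrA.
by rewrite -/p mulrV // mul1r subrr.
Qed.

(** The product of [a] and [b] is upper triangular with ones on the diagonal. If l > q, some nonzero
    v is killed by [b]; the row of the product at the last nonzero index i of v then gives v_i =
    0. *)
Lemma unitriangular_factor_size q l (a : 'I_l -> 'I_q -> E)
    (b : 'I_q -> 'I_l -> E) :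
  (forall i, \sum_m a i m * b m i = 1) ->
  (forall i j : 'I_l, (j < i)%N -> \sum_m a i m * b m j = 0) -> (l <= q)%N.
Proof.
move=> d1 t0; rewrite leqNgt; apply/negP => /(exists_kernel_vector b)[v [j0 vj0] hv].
case: (arg_maxnP (fun j : 'I_l => (j : nat)) (P := fun j => v j != 0) vj0) => i vi maxi.
have : \sum_m a i m * \sum_j b m j * v j = 0.
  by apply: big1 => m _; rewrite hv mulr0.
under eq_bigr do rewrite mulr_sumr.
rewrite exchange_big /= (bigD1 i) //= [X in _ + X]big1 => [|j ji]; last first.
  under eq_bigr do rewrite mulrA.
  rewrite -mulr_suml; have [ltji|leij] := ltnP j i.
    by rewrite t0 // mul0r.
  have [->|vj] := eqVneq (v j) 0; first by rewrite mulr0.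
  case/eqP: ji; apply: val_inj => /=; apply/eqP; rewrite eqn_leq leij andbT.
  exact: maxi.
under eq_bigr do rewrite mulrA.
by rewrite -mulr_suml d1 mul1r addr0 => /eqP; rewrite (negPf vi).
Qed.

Definition right_span C s : set E :=
  [set x | exists2 c : nat -> E, forall i, C (c i) &
     x = \sum_(i < size s) s`_i * c i].

Definition centralizer W : set E := [set c | forall w, W w -> GRing.comm c w].

Lemma centralizer_division_subring W : division_subring (centralizer W).
Proof.
split; rewrite ?in_setE.
- by move=> w _; apply: commr_sym; apply: commr1.
- move=> x y; rewrite !in_setE => Cx Cy w Ww.
  by apply/commr_sym/commrB; apply: commr_sym; auto.
- move=> x y; rewrite !in_setE => Cx Cy w Ww.
  by apply/commr_sym/commrM; [|apply: commrV]; apply: commr_sym; auto.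
Qed.

Lemma division_subringP A : division_subring A <->
  subring A /\ (forall x, A x -> A x^-1).
Proof.
split=> [[A1 AB AM]|[[A1 AB AM] AV]].
  have A1' : A 1 by rewrite -in_setE.
  have AB' x y : A x -> A y -> A (x - y).
    by rewrite -![A _]in_setE; apply: AB.
  have AV x : A x -> A x^-1.
    by move=> Ax; rewrite -div1r -[A _]in_setE; apply: AM; rewrite in_setE.
  split=> //; split=> // x y Ax Ay; rewrite -[y]invrK -[A _]in_setE.
  by apply: AM; rewrite in_setE //; apply: AV.
split; first by rewrite in_setE.
- by move=> x y; rewrite !in_setE; apply: AB.
- by move=> x y; rewrite !in_setE => Ax Ay; apply: AM => //; apply: AV.
Qed.

Lemma centralizer_subring W : subring (centralizer W).
Proof. by case/division_subringP: (centralizer_division_subring W). Qed.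

Lemma ring_centerE : ring_center E = centralizer [set: E].
Proof. by apply/seteqP; split=> [z cz w _|z cz w]; apply: cz. Qed.

Section RightSpan.
Variable C : set E.
Hypothesis rC : subring C.

Lemma right_span_cons y s c x :
  C c -> right_span C s (x - y * c) -> right_span C (y :: s) x.
Proof.
move=> Cc [d Cd e]; exists (fun i => if i is j.+1 then d j else c); first by case.
by rewrite big_ord_recl /= -e addrC subrK.
Qed.

Lemma right_span0 s : right_span C s 0.
Proof.
exists (fun=> 0); first by move=> _; apply: subring0.
by rewrite big1 // => i _; rewrite mulr0.
Qed.

Lemma right_spanD s x y : right_span C s x -> right_span C s y ->
  right_span C s (x + y).
Proof.
move=> [c Cc ->] [d Cd ->]; exists (fun i => c i + d i).
  by move=> i; apply: subringD.
by rewrite -big_split; apply: eq_bigr => i _; rewrite mulrDr.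
Qed.

Lemma right_spanM s x c : C c -> right_span C s x -> right_span C s (x * c).
Proof.
move=> Cc [d Cd ->]; exists (fun i => d i * c); first by move=> i; apply: subringM.
by rewrite mulr_suml; apply: eq_bigr => i _; rewrite mulrA.
Qed.

Lemma mem_right_span s y : y \in s -> right_span C s y.
Proof.
move=> ys; exists (fun i => (i == index y s)%:R).
  by move=> i; case: eqP => _; [case: rC|apply: subring0].
have ly : (index y s < size s)%N by rewrite index_mem.
rewrite (bigD1 (Ordinal ly)) //= eqxx mulr1 nth_index // big1 ?addr0 //.
move=> i ne; suff -> : (i == index y s :> nat) = false by rewrite mulr0.
by apply/negP => /eqP e; case/eqP: ne; apply: val_inj.
Qed.

Lemma right_span_sum s (I : Type) (t : seq I) (P : pred I) (F : I -> E) :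
  (forall i, P i -> right_span C s (F i)) ->
  right_span C s (\sum_(i <- t | P i) F i).
Proof.
by move=> hF; apply: (big_ind (right_span C s)) => //;
  [apply: right_span0|apply: right_spanD].
Qed.

(** Over a division subring this is right linear independence; the triangular form is the one
    matched by [unitriangular_factor_size]. *)
Definition chain_independent s : Prop := forall i, (i < size s)%N ->
  ~ right_span C (take i s) s`_i.

Lemma chain_independent_rcons s x : chain_independent s ->
  ~ right_span C s x -> chain_independent (rcons s x).
Proof.
move=> cs nx i; rewrite size_rcons ltnS leq_eqVlt => /orP[/eqP ->|lis].
  by rewrite nth_rcons ltnn eqxx -cats1 take_cat ltnn subnn take0 cats0.
by rewrite nth_rcons lis -cats1 take_cat lis; apply: cs.
Qed.

(** Grow a chain inside [P] as long as possible; the bound [q] makes this stop. *)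
Lemma exists_spanning_chain (P : set E) q :
  (forall s, chain_independent s -> (size s <= q)%N) ->
  exists s, [/\ chain_independent s, forall y, y \in s -> P y &
    forall x, P x -> right_span C s x].
Proof.
move=> bound.
suff grow n s : (q - size s <= n)%N -> chain_independent s ->
    (forall y, y \in s -> P y) -> exists s, [/\ chain_independent s,
      forall y, y \in s -> P y & forall x, P x -> right_span C s x].
  by apply: (grow q [::]) => //; rewrite subn0.
elim: n s => [|n IH] s len cs Ps;
  have [all_in|/existsNP[x /not_implyP[Px nx]]] :=
    pselect (forall x, P x -> right_span C s x); try by exists s.
all: have cs' := chain_independent_rcons cs nx.
all: have := bound _ cs'; rewrite size_rcons => lt.
  by move: len; rewrite leqNgt subn_gt0 lt.
apply: (IH (rcons s x)) => //; first by rewrite size_rcons; lia.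
by move=> y; rewrite mem_rcons inE => /orP[/eqP ->|/Ps].
Qed.

End RightSpan.

Section Density.
Variable W : set E.
Hypothesis rW : subring W.
Let C := centralizer W.

(** These operators come from left multiplications by [E] and right multiplications by [W]. The
    additive maps of [E] commuting with all of them are the right multiplications by [C], so density
    is relative to right spans over [C]. *)
Definition multiplication_op (T : E -> E) : Prop := exists2 l : seq (E * E),
  forall p, p \in l -> W p.2 & forall x, T x = \sum_(p <- l) p.1 * x * p.2.

Lemma multiplication_op_mull d T :
  multiplication_op T -> multiplication_op (fun x => d * T x).
Proof.
move=> [l Wl Tl]; exists [seq (d * p.1, p.2) | p <- l].
  by move=> _ /mapP[p pl ->]; exact: Wl pl.
by move=> x; rewrite Tl big_map mulr_sumr; apply: eq_bigr => p _; rewrite !mulrA.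
Qed.

Lemma multiplication_op_mulr w T : W w ->
  multiplication_op T -> multiplication_op (fun x => T x * w).
Proof.
move=> Ww [l Wl Tl]; exists [seq (p.1, p.2 * w) | p <- l].
  by move=> _ /mapP[p pl ->]; apply: subringM => //; exact: Wl pl.
by move=> x; rewrite Tl big_map mulr_suml; apply: eq_bigr => p _; rewrite !mulrA.
Qed.

Lemma multiplication_opD T U : multiplication_op T -> multiplication_op U ->
  multiplication_op (fun x => T x + U x).
Proof.
move=> [l Wl Tl] [k Wk Uk]; exists (l ++ k).
  by move=> p; rewrite mem_cat => /orP[/Wl|/Wk].
by move=> x; rewrite Tl Uk big_cat.
Qed.

Lemma multiplication_opB T U : multiplication_op T -> multiplication_op U ->
  multiplication_op (fun x => T x - U x).
Proof.
move=> oT oU; have := multiplication_opD oT (multiplication_op_mull (-1) oU).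
by move=> [l Wl e]; exists l => // x; rewrite -e mulN1r.
Qed.

Lemma multiplication_op_add T x y : multiplication_op T -> T (x + y) = T x + T y.
Proof.
move=> [l _ Tl]; rewrite !Tl -big_split; apply: eq_bigr => p _ /=.
by rewrite mulrDr mulrDl.
Qed.

Lemma multiplication_op_right T x c :
  multiplication_op T -> C c -> T (x * c) = T x * c.
Proof.
move=> [l Wl Tl] Cc; rewrite !Tl mulr_suml; apply: eq_big_seq => p /Wl Wp.
by rewrite -!mulrA (Cc _ Wp).
Qed.

Lemma multiplication_op0 T : multiplication_op T -> T 0 = 0.
Proof. by move=> [l _ ->]; apply: big1 => p _; rewrite mulr0 mul0r. Qed.

Lemma multiplication_op_sub T x y : multiplication_op T -> T (x - y) = T x - T y.
Proof.
move=> oT; apply: (addIr (T y)); rewrite subrK -multiplication_op_add //.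
by rewrite subrK.
Qed.

Lemma multiplication_op_sum T (I : Type) (t : seq I) (P : pred I) (F : I -> E) :
  multiplication_op T ->
  T (\sum_(i <- t | P i) F i) = \sum_(i <- t | P i) T (F i).
Proof.
move=> oT; apply: (big_morph T); last exact: multiplication_op0.
by move=> x y; apply: multiplication_op_add.
Qed.

(** Jacobson density, by induction on [s]. An operator T with T x = 1 that kills [s] has to be
    corrected so as to kill also y, whose value is c = T y. The correction depends on whether c lies
    in [C]. *)
Lemma density s x : right_span C s x \/ exists T, [/\ multiplication_op T,
  T x = 1 & forall y, y \in s -> T y = 0].
Proof.
elim: s x => [|y s IH] x.
  have [->|x0] := eqVneq x 0; first by left; apply/right_span0/centralizer_subring.
  right; exists (fun z => x^-1 * z); split=> //; last by rewrite mulVr ?divE.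
  exists [:: (x^-1, 1)] => [p|z]; last by rewrite big_seq1 mulr1.
  by rewrite inE => /eqP ->; case: rW.
have [xs|[T [oT Tx Ts]]] := IH x.
  left; apply: (right_span_cons (c := 0)); last by rewrite mulr0 subr0.
  by apply: subring0; apply: centralizer_subring.
pose c := T y; have [Cc|nCc] := pselect (C c); last first.
  have /existsNP[w /not_implyP[Ww nw]] := nCc.
  have d0 : w * c - c * w != 0.
    by apply/eqP => /subr0_eq e; apply: nw.
  set d := w * c - c * w in d0.
  (* If c does not commute with w, the commutator of T with right multiplication by w kills x and
     [s], and after scaling sends y to 1. *)
  pose S z := d^-1 * (w * T z - T z * w).
  have oS : multiplication_op S.
    apply: multiplication_op_mull; apply: multiplication_opB.
      exact: multiplication_op_mull.
    exact: multiplication_op_mulr.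
  right; exists (fun z => T z - c * S z); split.
  - by apply: multiplication_opB => //; apply: multiplication_op_mull.
  - by rewrite /S Tx mulr1 mul1r subrr !mulr0 subr0.
  - move=> z; rewrite inE => /orP[/eqP ->|zs].
      by rewrite /S -/c -/d mulVr ?divE // mulr1 subrr.
    by rewrite /S Ts // mulr0 mul0r subrr !mulr0 subr0.
pose y' := y - x * c.
have [y's|[S [oS Sy Ss]]] := IH y'.
  have [c0|c0] := eqVneq c 0.
    right; exists T; split=> // z; rewrite inE => /orP[/eqP ->|] //.
    exact: Ts.
  have CV : C c^-1.
    by case/division_subringP: (centralizer_division_subring W) => _; apply.
  left; apply: (right_span_cons CV).
  have -> : x - y * c^-1 = y' * (- c^-1).
    by rewrite /y' mulrBl !mulrN -mulrA mulrV ?divE // mulr1 opprK addrC.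
  apply: (right_spanM (centralizer_subring W)) => //.
  exact: (subringN (centralizer_subring W)).
(* Subtracting a left multiple of T makes S vanish at x while it keeps the value 1 at y' and 0 on
   [s]. *)
pose g := S x; pose U z := S z - g * T z.
have oU : multiplication_op U.
  by apply: multiplication_opB => //; apply: multiplication_op_mull.
have Ux : U x = 0 by rewrite /U Tx mulr1 subrr.
have Uy : U y = 1.
  have -> : y = y' + x * c by rewrite subrK.
  rewrite multiplication_op_add // multiplication_op_right // Ux mul0r addr0.
  rewrite /U Sy; suff -> : T y' = 0 by rewrite mulr0 subr0.
  by rewrite multiplication_op_sub // multiplication_op_right // Tx mul1r subrr.
right; exists (fun z => T z - c * U z); split.
- by apply: multiplication_opB => //; apply: multiplication_op_mull.
- by rewrite Tx Ux mulr0 subr0.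
- move=> z; rewrite inE => /orP[/eqP ->|zs]; first by rewrite Uy mulr1 subrr.
  by rewrite /U Ts // Ss // mulr0 subrr mulr0 subr0.
Qed.

Lemma chain_dual s : chain_independent C s -> exists T : nat -> E -> E,
  forall i, (i < size s)%N -> [/\ multiplication_op (T i), T i s`_i = 1 &
    forall j, (j < i)%N -> T i s`_j = 0].
Proof.
move=> cs.
suff: forall i, exists Ti : E -> E, (i < size s)%N -> [/\ multiplication_op Ti,
    Ti s`_i = 1 & forall j, (j < i)%N -> Ti s`_j = 0].
  by move=> /choice[T hT]; exists T.
move=> i; have [lis|gis] := ltnP i (size s); last by exists id.
have [/(cs i lis) //|[T [oT Ti Tj]]] := density (take i s) s`_i.
exists T => _; split=> // j ji; apply: Tj.
rewrite -(nth_take 0 ji); apply: mem_nth.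
by rewrite size_take lis.
Qed.

(** The unitriangular matrix of the T_i(s_j) factors through coordinates with respect to [g]. *)
Lemma chain_size_span s g : (forall x, right_span C g x) ->
  chain_independent C s -> (size s <= size g)%N.
Proof.
move=> gspan /chain_dual[T hT].
have /choice[c hc] j : exists c : nat -> E,
  (forall m, C (c m)) /\ s`_j = \sum_(m < size g) g`_m * c m.
  by have [c Cc e] := gspan s`_j; exists c.
have key (i : 'I_(size s)) j :
    \sum_(m < size g) T i g`_m * c j m = T i s`_j.
  have [oT _ _] := hT i (ltn_ord i); have [Cc ->] := hc j.
  rewrite multiplication_op_sum //; apply: eq_bigr => m _.
  by rewrite multiplication_op_right.
apply: (@unitriangular_factor_size _ _ (fun i m => T i g`_m) (fun m j => c j m)).
- by move=> i; rewrite key; case: (hT i).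
- by move=> i j ji; rewrite key; case: (hT i (ltn_ord i)) => _ _; apply.
Qed.

(** Central coefficients move to the left, so each operator has the form x -> sum of a_m x w_m with
    w_m in [ws], and the matrix of the T_i(s_j) factors through [size ws] coordinates. Thus [E] has
    dimension at most [size ws] over [C]. *)
Lemma chain_size_finite s ws : (forall w, W w -> right_span (ring_center E) ws w) ->
  chain_independent C s -> (size s <= size ws)%N.
Proof.
move=> hws /chain_dual[T hT].
have expand U : multiplication_op U -> exists a : nat -> E,
    forall x, U x = \sum_(m < size ws) a m * (x * ws`_m).
  move=> [l]; elim: l U => [|p l IH] U Wl Ul.
    by exists (fun=> 0) => x; rewrite Ul big_nil big1 // => m _; rewrite mul0r.
  have [||a ha] := IH (fun x => \sum_(p <- l) p.1 * x * p.2) => //.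
    by move=> q ql; apply: Wl; rewrite inE ql orbT.
  have [z Zz e] := hws _ (Wl p (mem_head _ _)).
  exists (fun m => a m + p.1 * z m) => x.
  rewrite Ul big_cons ha e addrC mulr_sumr -big_split; apply: eq_bigr => m _ /=.
  rewrite mulrDl; congr (_ + _); rewrite -!mulrA; congr (_ * _).
  by rewrite (Zz m (x * ws`_m)) mulrA.
have /choice[a ha] i : exists a : nat -> E, (i < size s)%N ->
    forall x, T i x = \sum_(m < size ws) a m * (x * ws`_m).
  have [lis|gis] := ltnP i (size s); last by exists (fun=> 0).
  by have [/expand[a ha] _ _] := hT i lis; exists a.
apply: (@unitriangular_factor_size _ _ (fun i m => a i m)
  (fun m j => s`_j * ws`_m)).
- by move=> i; rewrite -ha //; case: (hT i).
- by move=> i j ji; rewrite -ha //; case: (hT i (ltn_ord i)) => _ _; apply.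
Qed.

End Density.
End DivisionRingLinearAlgebra.

(** * Division subrings and their centers *)

Section SubDivisionRing.
Variables (D : unitRingType) (A : set D) (sA : division_subring A).

(** The closure proof is an argument of the predicate so that the closure instance, and with it the
    ring structure on the subtype, can be inferred. *)
Definition division_subring_pred of division_subring A : {pred D} := mem A.

HB.instance Definition _ :=
  GRing.isDivringClosed.Build D (division_subring_pred sA) sA.

Definition sub_division_ring : Type := {x : D | x \in division_subring_pred sA}.

HB.instance Definition _ := SubChoice.copy sub_division_ring
  {x : D | x \in division_subring_pred sA}.
HB.instance Definition _ :=
  [SubChoice_isSubUnitRing of sub_division_ring by <:].

End SubDivisionRing.


(** Turns a division subring into a division ring of its own, so that its center and spans over that
    center can be formed. *)
Lemma division_subring_type (D : unitRingType) (A : set D) :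
  GRing.field_axiom D -> division_subring A ->
  exists (E : unitRingType) (f : {rmorphism E -> D}),
    GRing.field_axiom E /\ forall x, A x <-> exists a, x = f a.
Proof.
move=> divD sA; exists (sub_division_ring sA), val; split=> [x x0|x].
  have Ux : val x \is a GRing.unit.
    by apply: divD; apply: contra_neq x0 => x0; apply: val_inj.
  have Ax' : (val x)^-1 \in A.
    have [A1 _ AM] : division_subring A by [].
    by rewrite -div1r; apply: AM => //; exact: (valP x).
  apply/unitrP; exists (Sub (val x)^-1 Ax').
  by split; apply: val_inj; rewrite rmorphM SubK ?mulVr ?mulrV.
split=> [Ax|[a ->]]; last exact: set_mem (valP a : val a \in A).
by exists (exist _ x (mem_set Ax)).
Qed.

Lemma commutative_division_field (E : unitRingType) :
  GRing.field_axiom E -> (forall x y : E, x * y = y * x) ->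
  exists (Z : fieldType) (f : {rmorphism Z -> E}), forall x, exists z, x = f z.
Proof.
move=> divE comE.
pose cC := GRing.PzRing_hasCommutativeMul.Build E comE.
pose cE : comUnitRingType := HB.pack (E : Type) cC E.
have domE : GRing.integral_domain_axiom cE.
  move=> x y xy0; case: (eqVneq x 0) => //= x0; apply/eqP.
  by rewrite -[y](mulKr (divE x x0)); apply/eqP; rewrite xy0 mulr0.
pose iE : idomainType := HB.pack (E : Type) cE (GRing.ComUnitRing_isIntegral.Build cE domE).
pose fE : fieldType := HB.pack (E : Type) iE (GRing.UnitRing_isField.Build iE divE).
pose f := (idfun : {rmorphism fE -> E}).
by exists fE, f => x; exists x.
Qed.

(** * Finite dimensionality over the center *)

Section FiniteOverCenter.
Implicit Types D E : unitRingType.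

Definition algebraic_over_center E : Prop := forall x : E,
  exists p : {poly E}, [/\ p != 0, coefs_in (ring_center E) p & p.[x] = 0].

Definition finite_over_center E : Prop :=
  exists g : seq E, forall x, right_span (ring_center E) g x.

Lemma subring_ring_center E : subring (ring_center E).
Proof. by rewrite ring_centerE; apply: centralizer_subring. Qed.

Lemma division_subring_center E : division_subring (ring_center E).
Proof. by rewrite ring_centerE; apply: centralizer_division_subring. Qed.

Lemma ring_center_inv E (z : E) : ring_center E z -> ring_center E z^-1.
Proof. by case/division_subringP: (division_subring_center E) => _; apply. Qed.

Section Algebraic.
Variable E : unitRingType.
Hypotheses (divE : GRing.field_axiom E) (algE : algebraic_over_center E).
Implicit Types (A W : set E) (x b s : E) (p q r : {poly E}).

(** Cancel powers of [b] in an algebraic relation until its constant term is nonzero; the inverse is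
    then a polynomial in [b] with central coefficients. *)
Lemma inverse_in_subring A b : subring A -> ring_center E `<=` A ->
  A b -> A b^-1.
Proof.
move=> rA ZA Ab; have [->|b0] := eqVneq b 0.
  by rewrite invr0; apply: subring0.
have Ub := divE b0; have [p [p0 Zp pb]] := algE b.
elim/poly_ind: p p0 Zp pb => [|p c IH]; first by rewrite eqxx.
move=> p0 Zp; rewrite hornerMXaddC => pb.
have Zc : ring_center E c.
  by have := Zp 0%N; rewrite coefD coefMX coefC /= add0r.
have {}Zp : coefs_in (ring_center E) p.
  by move=> i; have := Zp i.+1; rewrite coefD coefMX coefC /= addr0.
have [c0|c0] := eqVneq c 0.
  apply: IH => //; first by apply: contra_neq p0 => ->; rewrite c0 mul0r addr0.
  by rewrite -[LHS](mulrK Ub) -[X in X / b](addrK c) pb c0 subr0 mul0r.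
have -> : b^-1 = - (c^-1 * p.[b]).
  apply: (mulIr Ub); rewrite mulVr // mulNr -mulrA.
  rewrite (_ : p.[b] * b = - c) ?mulrN ?mulVr ?divE ?opprK //.
  by apply/eqP; rewrite -addr_eq0 pb.
apply: subringN => //; apply: subringM => //.
  by apply: ZA; apply: ring_center_inv.
by rewrite horner_coef; apply: subring_sum => // i _; apply: subringM => //;
  [apply: ZA|apply: subringX].
Qed.

Lemma reduce_powers W s p : subring W -> ring_center E `<=` W -> p != 0 ->
  coefs_in (ring_center E) p -> p.[s] = 0 ->
  (forall w, W w -> GRing.comm w s) -> forall q, coefs_in W q ->
  exists r : nat -> E, (forall i, W (r i)) /\
    q.[s] = \sum_(i < (size p).-1) r i * s ^+ i.
Proof.
move=> rW ZW p0 Zp ps Ws; set n := (size p).-1.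
have szp : size p = n.+1 by rewrite prednK // size_poly_gt0.
have l0 : p`_n != 0 by rewrite lead_coef_eq0.
elim/poly_ind => [|q c IH] Wq.
  exists (fun=> 0); split; first by move=> _; apply: subring0.
  by rewrite horner0 big1 // => i _; rewrite mul0r.
have Wc : W c by have := Wq 0%N; rewrite coefD coefMX coefC /= add0r.
have [|r [Wr rq]] := IH.
  by move=> i; have := Wq i.+1; rewrite coefD coefMX coefC /= addr0.
pose t i := if i is j.+1 then r j else c.
have Wt i : W (t i) by case: i => [|i] /=.
have tq : (q * 'X + c%:P).[s] = \sum_(i < n.+1) t i * s ^+ i.
  rewrite hornerMXaddC rq big_ord_recl /= expr0 mulr1 addrC; congr (_ + _).
  by rewrite mulr_suml; apply: eq_bigr => i _; rewrite -mulrA -exprSr.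
have Wl : W (p`_n)^-1 by apply: ZW; apply: ring_center_inv.
exists (fun i => t i - t n * (p`_n)^-1 * p`_i); split.
  move=> i; case: (rW) => _ WB WM; apply: WB => //; apply: (WM); last exact: ZW.
  exact: WM.
have pn : \sum_(i < n) p`_i * s ^+ i = - (p`_n * s ^+ n).
  apply/eqP; rewrite -addr_eq0; apply/eqP; move: ps.
  by rewrite horner_coef szp big_ord_recr.
rewrite tq big_ord_recr /=.
transitivity (\sum_(i < n) t i * s ^+ i
  - t n * (p`_n)^-1 * \sum_(i < n) p`_i * s ^+ i).
  by rewrite pn mulrN opprK -!mulrA (mulKr (divE l0)).
by rewrite mulr_sumr -sumrB; apply: eq_bigr => i _; rewrite mulrBl !mulrA.
Qed.

(* W is the subring generated by the center and the commuting elements S. *)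
Lemma finite_commutative_subring (S : seq E) :
  {in S &, forall x y, GRing.comm x y} ->
  exists W ws, [/\ subring W, ring_center E `<=` W, forall s, s \in S -> W s,
    forall w, W w -> right_span (ring_center E) ws w &
    forall x, (forall s, s \in S -> GRing.comm x s) -> centralizer W x].
Proof.
elim: S => [_|s S IH comS].
  exists (ring_center E), [:: 1]; split=> //; first exact: subring_ring_center.
    move=> w Zw; apply: (right_span_cons (c := w)) => //.
    by rewrite mul1r subrr; apply/right_span0/subring_ring_center.
  by move=> x _ w Zw; apply: commr_sym; apply: Zw.
have [|W [ws [rW ZW SW hws cW]]] := IH.
  by move=> x y xS yS; apply: comS; rewrite inE ?xS ?yS orbT.
have Ws w : W w -> GRing.comm w s.
  move=> Ww; apply: commr_sym; apply: cW => // y yS.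
  by apply: comS; rewrite inE ?eqxx ?yS ?orbT.
have rWs : subring (adjoin W s) by apply: subring_adjoin.
have [p [p0 Zp ps]] := algE s.
exists (adjoin W s), [seq w * s ^+ i | w <- ws, i <- iota 0 (size p).-1]; split=> //.
- exact: subset_trans (sub_adjoin _ _).
- move=> y; rewrite inE => /orP[/eqP ->|yS]; first exact: mem_adjoin.
  by apply: sub_adjoin => //; apply: SW.
- move=> _ [q Wq ->]; have [r [Wr ->]] := reduce_powers rW ZW p0 Zp ps Ws Wq.
  have rZ := subring_ring_center E.
  apply: right_span_sum => // i _; have [z Zz ->] := hws _ (Wr i).
  rewrite mulr_suml; apply: right_span_sum => // m _.
  rewrite -mulrA (Zz m) mulrA; apply: right_spanM => //.
  apply: mem_right_span => //; apply: allpairs_f; first exact: mem_nth.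
  by rewrite mem_iota add0n ltn_ord.
- move=> x xS w Ww; apply: commr_sym.
  have : centralizer [set x] w; last by apply.
  apply: adjoin_min Ww; first exact: centralizer_subring.
    move=> v Wv _ ->; apply: commr_sym; apply: cW => // y yS.
    by apply: xS; rewrite inE yS orbT.
  by move=> _ ->; apply: commr_sym; apply: xS; rewrite inE eqxx.
Qed.

(** [E] is finite over the centralizer of [W] by [chain_size_finite], and that centralizer lies in
    [W], which is finite over the center. *)
Lemma finite_over_center_of_centralizer W (ws : seq E) : subring W ->
  centralizer W `<=` W ->
  (forall w, W w -> right_span (ring_center E) ws w) -> finite_over_center E.
Proof.
move=> rW CW hws; have rC := centralizer_subring W.
have [s [_ _ hs]] := @exists_spanning_chain _ (centralizer W) [set: E] (size ws)
  (fun t cs => chain_size_finite divE rW hws cs).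
exists [seq x * w | x <- s, w <- ws] => x.
have rZ := subring_ring_center E.
have [c Cc ->] := hs x Logic.I; apply: right_span_sum => // i _.
have [z Zz ->] := hws _ (CW _ (Cc i)).
rewrite mulr_sumr; apply: right_span_sum => // m _; rewrite mulrA.
apply: right_spanM => //; apply: mem_right_span => //.
by apply: allpairs_f; apply: mem_nth.
Qed.

End Algebraic.

Lemma double_centralizer_subfield E (X : set E) :
  {in X &, forall x y, GRing.comm x y} ->
  subfield (centralizer (centralizer X)) /\ X `<=` centralizer (centralizer X).
Proof.
move=> comX.
have XC : X `<=` centralizer X.
  by move=> x Xx y Xy; apply: comX; apply: mem_set.
split; last by move=> x Xx y Cy; apply: commr_sym; apply: Cy.
split; first exact: centralizer_division_subring.
move=> x y; rewrite !in_setE => Cx Cy; apply: Cx => w Xw.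
by apply: Cy; apply: XC.
Qed.

(** If x centralizes [K], the double centralizer of [K] and x is a subfield containing both, hence
    equal to [K]. *)
Lemma maximal_subfield_centralizer E (K : set E) :
  maximal_subfield K -> centralizer K `<=` K.
Proof.
move=> [[dK comK] maxK] x Cx.
pose X := K `|` [set x].
have comX : {in X &, forall y z, GRing.comm y z}.
  move=> y z; rewrite !in_setE => -[Ky|->] [Kz|->] //.
  - by apply: comK; apply: mem_set.
  - by apply: commr_sym; apply: Cx.
  - exact: Cx.
have [sf XL] := double_centralizer_subfield comX.
by rewrite -(maxK _ sf) => [|y Ky]; apply: XL; [right|left].
Qed.

Lemma division_rmorph_inj E D (f : {rmorphism E -> D}) :
  GRing.field_axiom E -> injective f.
Proof.
move=> divE x y /eqP; rewrite -subr_eq0 -rmorphB => /eqP fxy.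
apply/eqP; rewrite -subr_eq0; apply: contraT => /divE Uxy.
have := oner_eq0 D; rewrite -(rmorph1 f) -(mulVr Uxy) rmorphM fxy mulr0.
by rewrite eqxx.
Qed.

Lemma rmorph_lift_seq E D (f : {rmorphism E -> D}) (Y : seq D) :
  (forall y, y \in Y -> exists a, y = f a) -> exists X, Y = map f X.
Proof.
elim: Y => [|y Y IH] hY; first by exists [::].
have [|X ->] := IH; first by move=> z zY; apply: hY; rewrite inE zY orbT.
have [a ->] := hY y (mem_head _ _); by exists (a :: X).
Qed.

(** Let [S0] be the finitely many elements of [S] not commuting with all of [Y], and [E] the
    centralizer of the rest [T] of [S]. Then [T] becomes central in [E]. With [W] generated by the
    center of [E] and [S0], whatever centralizes [W] in [E] centralizes [S], so it lies in K = F(S),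
    and hence in [W]. *)
Theorem finite_over_center_cover D (Y : seq D) :
  GRing.field_axiom D -> strongly_algebraic D ->
  exists (E : unitRingType) (f : {rmorphism E -> D}),
    [/\ GRing.field_axiom E, algebraic_over_center E, finite_over_center E &
      forall y, y \in Y -> exists a, y = f a].
Proof.
move=> divD [algD [K maxK [S [SK defK finS]]]].
have [S0 hS0] : exists S0 : seq D, (forall s, s \in S0 -> S s) /\
    forall s, S s -> s \notin S0 -> forall y, y \in Y -> GRing.comm y s.
  elim: Y => [|y Y [S0 [S0S hS0]]]; first by exists [::].
  have /finite_seqP[S1 hS1] := finS y.
  have S1E s : s \in S1 <-> S s /\ ~ GRing.comm y s.
    by rewrite -[_ /\ _]/([set z | S z /\ ~ GRing.comm y z] s) hS1.
  exists (S1 ++ S0); split.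
    by move=> s; rewrite mem_cat => /orP[/S1E[]|/S0S].
  move=> s Ss; rewrite mem_cat negb_or => /andP[nS1 nS0] z.
  rewrite inE => /orP[/eqP ->|zY]; last exact: hS0.
  by apply: contrapT => ncom; case/negP: nS1; apply/S1E.
case: hS0 => S0S hS0.
pose T : set D := [set s | S s /\ s \notin S0].
have [sfK maxK'] := maxK; have comK := sfK.2.
have comKK x y : K x -> K y -> GRing.comm x y.
  by move=> Kx Ky; apply: comK; apply: mem_set.
have [E [f [divE fE]]] := division_subring_type divD (centralizer_division_subring T).
have injf : injective f := @division_rmorph_inj _ _ f divE.
have centerE z : ring_center D z -> exists c, ring_center E c /\ z = f c.
  move=> Zz; have [|c e] := (fE z).1; first by move=> t _; apply: Zz.
  by exists c; split=> // x; apply: injf; rewrite !rmorphM /= -e; apply: Zz.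
have centerT t : T t -> exists c, ring_center E c /\ t = f c.
  move=> [St nt]; have [|c e] := (fE t).1.
    by move=> t' [St' _]; apply: comKK; apply: SK.
  exists c; split=> // x; apply: injf; rewrite !rmorphM /= -e.
  by apply: commr_sym; apply: (fE (f x)).2; [exists x|split].
have algE : algebraic_over_center E.
  move=> x; have [p [p0 Fp /rootP px]] := algD (f x).
  have /choice[c hc] i : exists c, ring_center E c /\ p`_i = f c.
    apply: centerE; have [lip|gip] := ltnP i (size p).
      by move/(all_nthP 0): Fp => /(_ i lip) /set_mem.
    by rewrite nth_default //; apply: subring0; apply: subring_ring_center.
  have ep : map_poly f (\poly_(i < size p) c i) = p.
    apply/polyP => i; rewrite coef_map coef_poly; case: ltnP => [_|szp].
      by case: (hc i).
    by rewrite /= rmorph0 nth_default.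
  exists (\poly_(i < size p) c i); split.
  - by apply: contra_neq p0 => e0; rewrite -ep e0 rmorph0.
  - move=> i; rewrite coef_poly; case: ifP => _; first by case: (hc i).
    by apply: subring0; apply: subring_ring_center.
  - by apply: injf; rewrite -horner_map ep px rmorph0.
have [|S0' eS0] := @rmorph_lift_seq _ _ f S0.
  move=> s /S0S Ss; apply/(fE s) => t [St _].
  by apply: comKK; apply: SK.
have memS0 s : s \in S0' -> S (f s).
  by move=> sS0; apply: S0S; rewrite eS0; apply: map_f.
have comS0 : {in S0' &, forall x y, GRing.comm x y}.
  move=> x y /memS0 Sx /memS0 Sy; apply: injf; rewrite !rmorphM.
  by apply: comKK; apply: SK.
have [W [ws [rW ZW S0W hws cW]]] := finite_commutative_subring divE algE comS0.
exists E, f; split=> //; last first.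
  by move=> y yY; apply/(fE y) => t [St nt]; apply: hS0.
apply: (finite_over_center_of_centralizer divE rW _ hws) => x Cx.
have CfxS : ring_center D `|` S `<=` centralizer [set f x].
  move=> s [Zs|Ss] _ ->; first exact: Zs.
  have [|sS0] := boolP (s \in S0).
    rewrite eS0 => /mapP[s' s'S0 ->]; rewrite /GRing.comm -!rmorphM.
    by congr (f _); apply: commr_sym; apply: Cx; apply: S0W.
  by apply: commr_sym; apply: (fE (f x)).2; [exists x|split].
have Kfx : K (f x).
  apply: (maximal_subfield_centralizer maxK) => y; rewrite defK => Ky.
  have : centralizer [set f x] y; last by move=> /(_ _ erefl); apply: commr_sym.
  exact: smallest_sub (centralizer_division_subring _) CfxS _ Ky.
(* By algebraicity [W] is closed under inverses, so its image is a division subring of [D]; it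
   contains the center and [S], hence all of [K]. *)
pose fW : set D := [set y | exists2 w, W w & y = f w].
have dfW : division_subring fW.
  case: (rW) => W1 WB WM; apply/division_subringP; split; first split.
  - by exists 1; rewrite ?rmorph1.
  - by move=> _ _ [v Wv ->] [w Ww ->]; exists (v - w); [apply: WB|rewrite rmorphB].
  - by move=> _ _ [v Wv ->] [w Ww ->]; exists (v * w); [apply: WM|rewrite rmorphM].
  - move=> _ [w Ww ->]; exists w^-1; first exact: inverse_in_subring.
    have [->|w0] := eqVneq w 0; first by rewrite invr0 rmorph0 invr0.
    by rewrite rmorphV ?divE.
have : fW (f x).
  move: Kfx; rewrite defK; apply: smallest_sub => // s [/centerE[c [Zc ->]]|Ss].
    by exists c => //; apply: ZW.
  have [|sS0] := boolP (s \in S0).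
    by rewrite eS0 => /mapP[s' s'S0 ->]; exists s' => //; apply: S0W.
  by have [//|c [Zc ->]] := centerT s; exists c => //; apply: ZW.
by case=> w Ww /injf ->.
Qed.
End FiniteOverCenter.

(** * Unbounded elements *)

(** Wedderburn's little theorem for bare operations, so that a quotient given by representatives
    need only supply the ring identities. *)
Lemma finite_domain_commutative (T : finType) (zero : T) (opp : T -> T)
    (add : T -> T -> T) (one : T) (mul : T -> T -> T) :
  associative add -> commutative add -> left_id zero add ->
  left_inverse zero opp add -> associative mul -> left_id one mul ->
  right_id one mul -> left_distributive mul add ->
  right_distributive mul add -> one != zero ->
  (forall x y, mul x y = zero -> x = zero \/ y = zero) -> commutative mul.
Proof.
move=> addA addC add0 addN mulA mul1 mul_1 mulDl mulDr one0 dom.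
pose rM := GRing.isNzRing.Build T addA addC add0 addN mulA mul1 mul_1 mulDl mulDr one0.
pose R : finNzRingType := HB.pack (T : Type) T rM.
pose U : finUnitRingType := HB.pack (T : Type) R (FinRing.isNzRing.Build R).
have domU : GRing.integral_domain_axiom U.
  by move=> x y /dom[->|->]; rewrite eqxx ?orbT.
exact: (@finDomain_mulrC U domU).
Qed.

(** * Finite quotients without zero divisors *)

Section FiniteQuotient.
Variables (R : nzRingType) (A I : set R).
Hypotheses (rA : subring A) (I0 : I 0) (I1 : ~ I 1).
Hypothesis IB : forall x y, I x -> I y -> I (x - y).
Hypothesis IMl : forall a x, A a -> I x -> I (a * x).
Hypothesis IMr : forall a x, A a -> I x -> I (x * a).
Hypothesis Iprime : forall x y, A x -> A y -> I (x * y) -> I x \/ I y.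
Variable s : seq R.
Hypothesis sfin : forall x, A x -> exists y, [/\ y \in s, A y & I (x - y)].

Let IN x : I x -> I (- x). Proof. by move=> Ix; rewrite -sub0r; apply: IB. Qed.
Let ID x y : I x -> I y -> I (x + y).
Proof. by move=> Ix Iy; rewrite -[y]opprK; apply: IB => //; apply: IN. Qed.

(** The quotient of [A] by [I] is realized on a finite list of canonical representatives, to which
    Wedderburn's theorem applies. *)
Lemma finite_quotient_commutative x y : A x -> A y -> I (x * y - y * x).
Proof.
(* The first representative in [s] that is congruent to x depends only on the class of x, so the
   fixed points of [r] serve as the quotient. *)
pose r x := nth 0 s (find (fun y => `[< A y /\ I (x - y) >]) s).
have rP z : A z -> [/\ r z \in s, A (r z) & I (z - r z)].
  move=> Az; have h : has (fun y => `[< A y /\ I (z - y) >]) s.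
    by have [w [ws Aw Iw]] := sfin Az; apply/hasP; exists w => //; apply/asboolP.
  have /asboolP[Aw Iw] := nth_find 0 h; split=> //.
  by apply: mem_nth; rewrite -has_find.
have req u v : I (u - v) -> r u = r v.
  move=> Iuv; rewrite /r; congr (nth _ _ _); apply: eq_find => w.
  apply: asbool_equiv_eq; split=> -[Aw Iw]; split=> //.
    have -> : v - w = (u - w) - (u - v) by rewrite opprB [RHS]addrC addrA subrK.
    exact: IB.
  have -> : u - w = (u - v) + (v - w) by rewrite addrA subrK.
  exact: ID.
have A0 : A 0 by apply: subring0.
pose l := [seq y <- s | `[< A y /\ r y = y >]].
have rl z : A z -> r z \in l.
  move=> Az; have [rs Ar Ir] := rP z Az; rewrite mem_filter rs andbT.
  apply/asboolP; split=> //; apply: req; rewrite -opprB; exact: IN.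
pose pr z : seq_sub l := insubd (SeqSub (rl 0 A0)) (r z).
have vpr z : A z -> val (pr z) = r z by move=> Az; rewrite insubdK //; exact: (rl z Az).
have valP' (u : seq_sub l) : A (val u) /\ r (val u) = val u.
  by have := valP u; rewrite mem_filter => /andP[/asboolP].
have Av (u : seq_sub l) : A (val u) by case: (valP' u).
have prv (u : seq_sub l) : pr (val u) = u.
  by apply: val_inj; rewrite vpr //; case: (valP' u).
have preq z w : I (z - w) -> pr z = pr w by move=> /req; rewrite /pr => ->.
have Ipr z : A z -> I (val (pr z) - z).
  by move=> Az; rewrite vpr // -opprB; apply: IN; case: (rP z Az).
pose addT (u v : seq_sub l) : seq_sub l := pr (val u + val v).
pose mulT (u v : seq_sub l) : seq_sub l := pr (val u * val v).
pose oppT (u : seq_sub l) : seq_sub l := pr (- val u).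
have prD z w : A z -> A w -> addT (pr z) (pr w) = pr (z + w).
  by move=> Az Aw; apply: preq; rewrite opprD addrACA; apply: ID; apply: Ipr.
have prM z w : A z -> A w -> mulT (pr z) (pr w) = pr (z * w).
  move=> Az Aw; apply: preq.
  have -> : val (pr z) * val (pr w) - z * w =
      (val (pr z) - z) * val (pr w) + z * (val (pr w) - w).
    by rewrite mulrBl mulrBr addrA subrK.
  by apply: ID; [apply: IMr|apply: IMl] => //; apply: Ipr.
have prN z : A z -> oppT (pr z) = pr (- z).
  by move=> Az; apply: preq; rewrite -opprD; apply/IN/Ipr.
have A1 : A 1 by case: rA.
have mulAB z w : A z -> A w -> A (z * w) by apply: subringM.
have addAB z w : A z -> A w -> A (z + w) by apply: subringD.
have oppA z : A z -> A (- z) by apply: subringN.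
have comm : commutative mulT.
  apply: (@finite_domain_commutative _ (pr 0) oppT addT (pr 1) mulT).
  - move=> u v w; rewrite -(prv u) -(prv v) -(prv w) !prD ?addrA //; auto.
  - by move=> u v; rewrite /addT addrC.
  - by move=> u; rewrite -(prv u) prD ?add0r.
  - by move=> u; rewrite -(prv u) prN // prD ?addNr //; auto.
  - move=> u v w; rewrite -(prv u) -(prv v) -(prv w) !prM ?mulrA //; auto.
  - by move=> u; rewrite -(prv u) prM ?mul1r.
  - by move=> u; rewrite -(prv u) prM ?mulr1.
  - move=> u v w; rewrite -(prv u) -(prv v) -(prv w) !(prM, prD) ?mulrDl //; auto.
  - move=> u v w; rewrite -(prv u) -(prv v) -(prv w) !(prM, prD) ?mulrDr //; auto.
  - apply/eqP => /(congr1 val) e; apply: I1.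
    have -> : 1 = (val (pr 0) - 0) - (val (pr 1) - 1) :> R.
      by rewrite e subr0 opprB addrCA subrr addr0.
    by apply: IB; apply: Ipr.
  - have pr0 z : A z -> pr z = pr 0 -> I z.
      move=> Az /(congr1 val) e.
      have -> : z = (val (pr 0) - 0) - (val (pr z) - z).
        by rewrite e subr0 opprB addrCA subrr addr0.
      by apply: IB; apply: Ipr.
    have pr0' (u : seq_sub l) : I (val u) -> u = pr 0.
      by move=> Iu; rewrite -(prv u); apply: preq; rewrite subr0.
    move=> u v /(pr0 _ (mulAB _ _ (Av u) (Av v)))/Iprime.
    by case=> // [/pr0'|/pr0']; [left|right].
move=> Ax Ay; have := comm (pr x) (pr y); rewrite !prM // => /(congr1 val) e.
have -> : x * y - y * x = (val (pr (y * x)) - y * x) - (val (pr (x * y)) - x * y).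
  by rewrite e opprB [RHS]addrC addrA subrK.
by apply: IB; apply: Ipr; apply: mulAB.
Qed.
End FiniteQuotient.

Lemma right_span_trans (E : unitRingType) (C : set E) (s g : seq E) x :
  subring C -> (forall y, y \in g -> right_span C s y) ->
  right_span C g x -> right_span C s x.
Proof.
move=> rC gs [c Cc ->]; apply: right_span_sum => // i _.
by apply: right_spanM => //; apply: gs; apply: mem_nth.
Qed.

Lemma center_field (E : unitRingType) : GRing.field_axiom E ->
  exists (Z : fieldType) (f : {rmorphism Z -> E}),
    forall x, ring_center E x <-> exists z, x = f z.
Proof.
move=> divE; have [F [g [divF gP]]] := division_subring_type divE (division_subring_center E).
have ginj : injective g := @division_rmorph_inj _ _ g divF.
have comF (x y : F) : x * y = y * x.
  by apply: ginj; rewrite !rmorphM; apply: (gP (g x)).2; exists x.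
have [Z [f fP]] := commutative_division_field divF comF.
exists Z, (g \o f : {rmorphism _ -> _}) => x; rewrite gP.
split=> [[a ->]|[z ->]]; last by exists (f z).
by have [z ->] := fP a; exists z.
Qed.

(** * Coordinates over the center, lattices and unbounded elements *)

Section Unbounded.
Variables (E : unitRingType) (N : set E) (gens : seq E).
Hypothesis divE : GRing.field_axiom E.
Hypothesis NV : forall x, N x -> N x^-1.
Hypothesis N0 : forall x, N x -> x != 0.
Hypothesis gensP : forall A : set E, A 1 ->
  (forall x y, A x -> A y -> A (x * y)) ->
  (forall g, g \in gens -> A g) -> N `<=` A.

Section Coordinates.
Variables (Z : fieldType) (f : {rmorphism Z -> E}).
Hypothesis fP : forall x, ring_center E x <-> exists z, x = f z.
Variables (d : nat) (e : 'I_d -> E) (co : E -> 'I_d -> Z).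
Hypothesis eN : forall i, N (e i).
Hypothesis coK : forall x, x = \sum_i e i * f (co x i).
Hypothesis co_uniq : forall (v : 'I_d -> Z) i, co (\sum_i e i * f (v i)) i = v i.

Let fC z x : f z * x = x * f z.
Proof. by apply: (fP (f z)).2; exists z. Qed.

Lemma coD x y i : co (x + y) i = co x i + co y i.
Proof.
rewrite {1}(coK x) {1}(coK y) -big_split /=.
under eq_bigr do rewrite -mulrDr -rmorphD.
exact: (co_uniq (fun i => co x i + co y i)).
Qed.

Lemma coZ x z i : co (x * f z) i = co x i * z.
Proof.
rewrite {1}(coK x) mulr_suml.
under eq_bigr do rewrite -mulrA -rmorphM.
exact: (co_uniq (fun i => co x i * z)).
Qed.

Lemma co0 i : co 0 i = 0.
Proof. by have := coZ 0 0 i; rewrite mul0r mulr0. Qed.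

Lemma coB x y i : co (x - y) i = co x i - co y i.
Proof.
by apply: (addIr (co y i)); rewrite subrK -coD subrK.
Qed.

Lemma co_sum (I : Type) (r : seq I) (P : pred I) (F : I -> E) i :
  co (\sum_(j <- r | P j) F j) i = \sum_(j <- r | P j) co (F j) i.
Proof.
by apply: (big_morph (fun x => co x i)) => [x y|]; [apply: coD|apply: co0].
Qed.

Lemma co_e j i : co (e j) i = (i == j)%:R.
Proof.
have -> : e j = \sum_i e i * f (i == j)%:R.
  rewrite (bigD1 j) //= eqxx rmorph1 mulr1 big1 ?addr0 // => k /negPf ->.
  by rewrite rmorph0 mulr0.
exact: (co_uniq (fun i => (i == j)%:R)).
Qed.

Lemma co_mul x y k :
  co (x * y) k = \sum_i \sum_j co x i * co y j * co (e i * e j) k.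
Proof.
rewrite {1}(coK x) {1}(coK y) mulr_suml co_sum; apply: eq_bigr => i _.
rewrite mulr_sumr co_sum; apply: eq_bigr => j _.
have -> : e i * f (co x i) * (e j * f (co y j)) =
    e i * e j * f (co x i * co y j).
  by rewrite rmorphM mulrA -(mulrA (e i) (f _)) fC !mulrA.
by rewrite coZ mulrC.
Qed.

Lemma right_span_co (s : seq E) x k : (forall y, y \in s -> co y k = 0) ->
  right_span (ring_center E) s x -> co x k = 0.
Proof.
move=> s0 [c Zc ->]; rewrite co_sum big1 // => i _.
by have [z ->] := (fP _).1 (Zc i); rewrite coZ s0 ?mul0r // mem_nth.
Qed.

(** By density with W = E, some operator sends e_k to 1 and kills the other basis elements. It is
    linear over the center, so it is the k-th coordinate. *)
Lemma co_op k : exists l : seq (E * E),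
  forall x, \sum_(p <- l) p.1 * x * p.2 = f (co x k).
Proof.
have rT : subring [set: E] by split.
have [sp|[T [oT Tk T0]]] := density divE rT [seq e j | j <- enum 'I_d & j != k] (e k).
  have : co (e k) k = 0.
    apply: right_span_co; last by rewrite ring_centerE; apply: sp.
    move=> y /mapP[j]; rewrite mem_filter => /andP[jk _] ->.
    by rewrite co_e eq_sym (negPf jk).
  by rewrite co_e eqxx => /eqP; rewrite oner_eq0.
have [l _ Tl] := oT; exists l => x.
rewrite -Tl {1}(coK x) (multiplication_op_sum _ _ _ oT) (bigD1 k) //=.
have Tr i : T (e i * f (co x i)) = T (e i) * f (co x i).
  by apply: (multiplication_op_right _ oT) => w _; apply: fC.
rewrite Tr Tk mul1r big1 ?addr0 // => i ik.
rewrite Tr T0 ?mul0r //; apply: map_f; by rewrite mem_filter ik mem_enum.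
Qed.

Definition lattice (S : set Z) : set E := [set x | forall i, S (co x i)].

Lemma lattice_subring (S : set Z) : subring S ->
  (forall i j k, S (co (e i * e j) k)) -> (forall k, S (co 1 k)) ->
  subring (lattice S).
Proof.
move=> rS Se S1; split=> // x y Sx Sy i.
  by rewrite coB; case: rS => _ SB _; apply: SB.
rewrite co_mul; apply: subring_sum => // j _; apply: subring_sum => // k _.
by do 2?apply: subringM.
Qed.

(** [U] consists of the nonzero elements no central multiple of which is a unit of the order
    [lattice V], for a place [V] finite on a ring [A] of definition. Elements of [N] are units of
    that order; existence of an unbounded element rests on Wedderburn's theorem. *)
Lemma exists_unbounded_set (x0 y0 : E) : N x0 -> N y0 -> x0 * y0 != y0 * x0 ->
  exists U : set E, [/\ exists a, U a, forall a, U a -> a != 0,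
    forall a, U a -> exists x, N x /\ U (a * x * a^-1) &
    forall x, N x -> ~ U x].
Proof.
move=> Nx0 Ny0 ncom; set c := x0 * y0 - y0 * x0.
have [i0 ci0] : exists i, co c i != 0.
  apply: contrapT => no; case/negP: ncom; rewrite -subr_eq0 -/c (coK c).
  apply/eqP/big1 => i _; have [->|ci] := eqVneq (co c i) 0.
    by rewrite rmorph0 mulr0.
  by case: no; exists i.
have /choice[l hl] := co_op.
(* These coordinates define over [A] the multiplication, the unit, the generators of [N] and the
   coordinate operators. The inverse of a coordinate of [c] is added to keep [c] nonzero modulo
   nonunits. *)
pose L := [seq e i * e j | i <- enum 'I_d, j <- enum 'I_d] ++ 1 :: gens ++
  flatten [seq [seq p.1 | p <- l k] ++ [seq p.2 | p <- l k] | k <- enum 'I_d].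
have [V [A [vV rA AV fA XA]]] := finite_place
  ((co c i0)^-1 :: [seq co x i | x <- L, i <- enum 'I_d]).
have rV : subring V by case: vV.
have AL x i : x \in L -> A (co x i).
  move=> xL; apply: XA; rewrite inE; apply/orP; right.
  by apply: allpairs_f => //; rewrite mem_enum.
have Ae i j k : A (co (e i * e j) k).
  apply: AL; rewrite mem_cat; apply/orP; left.
  by apply: (allpairs_f (fun i j => e i * e j)); rewrite mem_enum.
have A1 k : A (co 1 k) by apply: AL; rewrite mem_cat inE eqxx orbT.
have Agens g : g \in gens -> lattice A g.
  by move=> gg i; apply: AL; rewrite mem_cat inE mem_cat gg !orbT.
have Al k p : p \in l k -> lattice A p.1 /\ lattice A p.2.
  move=> pk; suff pL : p.1 \in L /\ p.2 \in L.
    by split=> i; apply: AL; case: pL.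
  split; rewrite mem_cat inE mem_cat; do 3?[apply/orP; right];
    apply/flatten_mapP; exists k; rewrite ?mem_enum // mem_cat;
    apply/orP; [left|right]; exact: map_f.
have rLA : subring (lattice A) by apply: lattice_subring.
have LAV : lattice A `<=` lattice V by move=> x Ax i; apply: AV.
have rLV : subring (lattice V).
  by apply: lattice_subring => // *; apply: AV.
have NLA : N `<=` lattice A.
  by apply: gensP => //; case: rLA.
set m := nonunits V; have LmV : lattice m `<=` lattice V.
  by move=> x mx i; case: (mx i).
have mMl a x : lattice V a -> lattice m x -> lattice m (a * x).
  move=> Va mx k; rewrite co_mul; apply: nonunits_sum => // i _.
  apply: nonunits_sum => // j _; rewrite mulrAC; apply: (nonunitsM vV _ (mx j)).
  by apply: subringM => //; apply: AV.
have mMr a x : lattice V a -> lattice m x -> lattice m (x * a).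
  move=> Va mx k; rewrite co_mul; apply: nonunits_sum => // i _.
  apply: nonunits_sum => // j _; rewrite -mulrA mulrC; apply: (nonunitsM vV _ (mx i)).
  by apply: subringM => //; apply: AV.
have mD x y : lattice m x -> lattice m y -> lattice m (x + y).
  by move=> mx my i; rewrite coD; apply: (nonunitsD vV (mx i) (my i)).
have m0 : lattice m 0 by move=> i; rewrite co0; apply: nonunits0.
have Vz x z : lattice V x -> V z -> lattice V (x * f z).
  by move=> Vx Vz i; rewrite coZ; apply: (subringM rV (Vx i) Vz).
have mz x z : lattice V x -> m z -> lattice m (x * f z).
  by move=> Vx mz i; rewrite coZ; apply: (nonunitsM vV (Vx i) mz).
have fV z : f z^-1 = (f z)^-1.
  have [->|z0] := eqVneq z 0; first by rewrite invr0 rmorph0 invr0.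
  by rewrite rmorphV // unitfE.
have f0 z : z != 0 -> f z != 0 by move=> z0; rewrite fmorph_eq0.
have U (a : E) : a != 0 -> a \is a GRing.unit by apply: divE.
have mul0 (a b : E) : a != 0 -> b != 0 -> a * b != 0.
  by move=> a0 b0; apply/eqP => ab; case/eqP: b0; rewrite -(mulKr (U _ a0) b) ab mulr0.
have inv0 (a : E) : a != 0 -> a^-1 != 0 by move=> a0; rewrite invr_eq0.
have invM (a b : E) : a != 0 -> b != 0 -> (a * b)^-1 = b^-1 * a^-1.
  by move=> a0 b0; rewrite invrM ?U.
(* Modulo the maximal ideal of V a primitive element is nonzero, and a bounded
   one is, up to a scalar, a unit of the lattice.  Scale an unbounded a and its
   inverse to primitive elements a' and b': some x in N makes a' * x * b'
   primitive, and if a * x * a^-1 were bounded, a' * x * b' and thus a' would be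
   units of the lattice. *)
pose prim a := lattice V a /\ ~ lattice m a.
pose bdd a := exists z, [/\ z != 0, lattice V (a * f z) & lattice V (a * f z)^-1].
have prim0 a : prim a -> a != 0.
  by move=> [_ nm]; apply: contra_notN nm => /eqP ->.
have prim_scale a : a != 0 -> exists2 z, z != 0 & prim (a * f z).
  move=> a0; have [i1 ai1] : exists i, co a i != 0.
    apply: contrapT => no; case/eqP: a0; rewrite (coK a); apply: big1 => i _.
    have [->|ai] := eqVneq (co a i) 0; first by rewrite rmorph0 mulr0.
    by case: no; exists i.
  (* Divide by a coordinate that every other coordinate is a [V]-multiple of. *)
  have [i [ai maxi]] : exists i, co a i != 0 /\
      forall j, j \in enum 'I_d -> V (co a j / co a i).
    elim: (enum 'I_d) => [|j s [i [ai IH]]]; first by exists i1.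
    have [Vij|] : V (co a j / co a i) \/ V (co a j / co a i)^-1.
      by case: vV => _; apply.
      by exists i; split=> // k; rewrite inE => /orP[/eqP ->|/IH].
    rewrite invf_div => Vji; have [aj|aj] := eqVneq (co a j) 0.
      exists i; split=> // k; rewrite inE => /orP[/eqP ->|/IH //].
      by rewrite aj mul0r; apply: subring0.
    exists j; split=> // k; rewrite inE => /orP[/eqP ->|/IH Vk].
      by rewrite divff //; case: rV.
    have -> : co a k / co a j = (co a k / co a i) * (co a i / co a j).
      by field; rewrite aj ai.
    exact: subringM.
  exists (co a i)^-1; rewrite ?invr_eq0 //; split.
    by move=> j; rewrite coZ; apply: maxi; rewrite mem_enum.
  by move=> /(_ i); rewrite coZ divff //; apply: nonunits1.
(* If every a x b with x in [N] vanished modulo nonunits, so would a y b for every y of the lattice,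
   as [N] contains the basis. The coordinate operators then make (co a k) b vanish for all k,
   against primitivity of a and b. *)
have prim_mul a b : prim a -> prim b -> exists2 x, N x & prim (a * x * b).
  move=> [Va na] [Vb nb]; apply: contrapT => no.
  have maxb x : N x -> lattice m (a * x * b).
    move=> Nx; apply: contrapT => nm; apply: no; exists x => //; split=> //.
    by do 2?[apply: (subringM rLV)] => //; apply/LAV/NLA.
  have mab y : lattice V y -> lattice m (a * y * b).
    move=> Vy; rewrite (coK y) mulr_sumr mulr_suml.
    apply: (big_ind (lattice m)) => // i _.
    rewrite mulrA -mulrA fC mulrA.
    by move=> k; rewrite coZ mulrC; apply: (nonunitsM vV (Vy i)); apply: maxb.
  have /existsNP[k nk] := na; apply: nb => j.
  suff : m (co b j * co a k).
    by case/(nonunits_prime vV (Vb j) (Va k)).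
  rewrite -coZ -fC -hl mulr_suml.
  suff mm : lattice m (\sum_(p <- l k) p.1 * a * p.2 * b) by apply: mm.
  rewrite big_seq; apply: (big_ind (lattice m)) => // p pk.
  have [A1p A2p] := Al k p pk.
  by rewrite -!mulrA; apply: mMl; [apply: LAV|rewrite mulrA; apply: mab; apply: LAV].
have bdd_prim a : prim a -> bdd a -> lattice V a^-1.
  move=> pa [z [z0 Vaz Vaz']]; have a0 := prim0 _ pa.
  have [Vzz|nVz] := pselect (V z).
    have -> : a^-1 = (a * f z)^-1 * f z.
      by rewrite invM ?f0 // -fC mulVKr ?U ?f0.
    exact: Vz.
  case: pa => _; case; have -> : a = a * f z * f z^-1.
    by rewrite fV mulrK ?U ?f0.
  by apply: mz => //; apply: nonunits_inv.
(* Otherwise the finite ring of A-integral elements modulo nonunits has no zero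
   divisors, although the commutator c survives in it. *)
have [a1 a10 na1] : exists2 a, a != 0 & ~ bdd a.
  apply: contrapT => no.
  have primV a : prim a -> lattice V a^-1.
    move=> pa; apply: bdd_prim => //; apply: contrapT => nb.
    by apply: no; exists a => //; apply: prim0.
  have mB x y : lattice m x -> lattice m y -> lattice m (x - y).
    by move=> mx my i; rewrite coB; apply: (nonunitsB vV (mx i) (my i)).
  have nc : ~ lattice m c.
    move=> /(_ i0); apply: inv_unit => //; apply: AV; apply: XA.
    exact: mem_head.
  have nm1 : ~ lattice m 1.
    move=> m1; apply: nc; rewrite -[c]mul1r; apply: mMr => //; apply: LAV.
    by case: (rLA) => _ AB AM; apply: AB; apply: AM; apply: NLA.
  have [s hs] := fA.
  pose reps := [seq \sum_i e i * f (val (g i))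
    | g : {ffun 'I_d -> seq_sub s} <- enum {ffun 'I_d -> seq_sub s}].
  have fin x : lattice A x -> exists y,
      [/\ y \in reps, lattice A y & (lattice A `&` lattice m) (x - y)].
    move=> Ax; have /choice[g hg] i : exists z : seq_sub s,
        A (val z) /\ m (co x i - val z).
      by have [z [zs Az mz']] := hs _ (Ax i); exists (SeqSub zs).
    have cog i : co (\sum_i e i * f (val (g i))) i = val (g i).
      exact: (co_uniq (fun i => val (g i))).
    have Ag : lattice A (\sum_i e i * f (val (g i))).
      by move=> i; rewrite cog; case: (hg i).
    exists (\sum_i e i * f (val (g i))); split=> //.
      apply/mapP; exists [ffun i => g i]; first by rewrite mem_enum.
      by apply: eq_bigr => i _; rewrite ffunE.
    split; first by case: (rLA) => _ AB _; apply: AB.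
    by move=> i; rewrite coB cog; case: (hg i).
  apply: nc; suff: (lattice A `&` lattice m) c by case.
  have [A0 AB AM] : [/\ lattice A 0, forall x y, lattice A x -> lattice A y ->
      lattice A (x - y) & forall x y, lattice A x -> lattice A y -> lattice A (x * y)].
    by split; [apply: subring0|case: rLA|case: rLA].
  apply: (finite_quotient_commutative rLA _ _ _ _ _ _ fin) => //.
  - by case.
  - by move=> x y [Ax mx] [Ay my]; split; [apply: AB|apply: mB].
  - by move=> x y Ax [Ay my]; split; [apply: AM|apply: mMl => //; apply: LAV].
  - by move=> x y Ax [Ay my]; split; [apply: AM|apply: mMr => //; apply: LAV].
  - move=> x y Ax Ay [_ mxy]; have [mx|nx] := pselect (lattice m x).
      by left.
    right; split=> //; have px : prim x by split=> //; apply: LAV.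
    have -> : y = x^-1 * (x * y) by rewrite mulKr ?U // prim0.
    by apply: mMl => //; apply: primV.
  - exact: NLA.
  - exact: NLA.
exists [set a | a != 0 /\ ~ bdd a]; split.
- by exists a1.
- by move=> a [].
- move=> a [a0 na]; have [z z0 pz] := prim_scale a a0.
  have [w w0 pw] := prim_scale _ (inv0 _ a0).
  have [x Nx pxb] := prim_mul _ _ pz pw; exists x; split=> //.
  have x0' := N0 Nx; split; first exact: (mul0 _ _ (mul0 _ _ a0 x0') (inv0 _ a0)).
  move=> [t [t0 Vt Vt']]; apply: na; exists z; split=> //; first by case: pz.
  have eab : a * f z * x * (a^-1 * f w) = a * x * a^-1 * f (z * w).
    by rewrite -(mulrA a) fC rmorphM !mulrA -(mulrA _ (f z) a^-1) fC !mulrA.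
  have zw0 : z * w != 0 by rewrite mulf_neq0.
  have Vab : lattice V (a * f z * x * (a^-1 * f w))^-1.
    apply: bdd_prim => //; exists ((z * w)^-1 * t); split.
    - by rewrite mulf_neq0 ?invr_eq0.
    - by rewrite eab -mulrA -rmorphM mulVKf.
    - by rewrite eab -mulrA -rmorphM mulVKf.
  have az0 : a * f z != 0 by apply: mul0 => //; apply: f0.
  have bw0 : a^-1 * f w != 0 by apply: mul0; [apply: inv0|apply: f0].
  have -> : (a * f z)^-1 = x * (a^-1 * f w) * (a * f z * x * (a^-1 * f w))^-1.
    rewrite -(mulrA (a * f z)) [in RHS]invM //; last exact: mul0.
    by rewrite mulVKr ?U //; apply: mul0.
  apply: (subringM rLV) => //; apply: (subringM rLV); first exact/LAV/NLA.
  by case: pw.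
- move=> x Nx [x0' []]; exists 1; rewrite oner_neq0 rmorph1 mulr1.
  by split=> //; apply: LAV; apply: NLA => //; apply: NV.
Qed.
End Coordinates.
End Unbounded.

(** Such a [U] is incompatible with subnormality: conjugating elements of [N] by elements of [U]
    leads down a subnormal chain to an element of [U] in [N]. *)
Definition has_unbounded_set (E : unitRingType) (N : set E) : Prop :=
  exists U : set E, [/\ exists a, U a, forall a, U a -> a != 0,
    forall a, U a -> exists x, N x /\ U (a * x * a^-1) &
    forall x, N x -> ~ U x].

Lemma has_unbounded_set_image (E D : unitRingType) (f : {rmorphism E -> D})
    (N : set D) : GRing.field_axiom E -> (forall x, N x -> exists a, x = f a) ->
  has_unbounded_set [set a | N (f a)] -> has_unbounded_set N.
Proof.
move=> divE Nf [U [[a0 Ua0] U0 Uconj UN]].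
have finj := @division_rmorph_inj _ _ f divE.
exists [set y | exists2 a, U a & y = f a]; split.
- by exists (f a0), a0.
- move=> _ [a Ua ->]; apply/eqP => fa; case/eqP: (U0 a Ua).
  by apply: finj; rewrite fa rmorph0.
- move=> _ [a Ua ->]; have [x [Nx Uax]] := Uconj a Ua; exists (f x); split=> //.
  by exists (a * x * a^-1); rewrite // !rmorphM rmorphV // divE // U0.
- by move=> x Nx [a Ua e]; apply: (UN a) => //; rewrite /= -e.
Qed.

Lemma chain_size_center (E : unitRingType) (g s : seq E) :
  GRing.field_axiom E -> (forall x, right_span (ring_center E) g x) ->
  chain_independent (ring_center E) s -> (size s <= size g)%N.
Proof.
by move=> divE; rewrite ring_centerE => gspan; exact: (chain_size_span divE).
Qed.

(** A maximal chain drawn from [P] spans because [e0] does. In a nontrivial relation the last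
    nonzero coefficient would express an entry through its predecessors, so coordinates are
    unique. *)
Lemma center_basis (E : unitRingType) (P : set E) (e0 : seq E) :
  GRing.field_axiom E -> (forall x, x \in e0 -> P x) ->
  (forall x, right_span (ring_center E) e0 x) ->
  exists (Z : fieldType) (f : {rmorphism Z -> E}) (d : nat) (e : 'I_d -> E)
    (co : E -> 'I_d -> Z), [/\ forall x, ring_center E x <-> exists z, x = f z,
    forall i, P (e i), forall x, x = \sum_i e i * f (co x i) &
    forall (v : 'I_d -> Z) i, co (\sum_i e i * f (v i)) i = v i].
Proof.
move=> divE e0P e0_span.
have [Z [f fP]] := center_field divE.
have rC := subring_ring_center E.
have [s [cs sP Ps]] := @exists_spanning_chain E (ring_center E) P (size e0)
  (fun s => chain_size_center divE e0_span (s := s)).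
have span x : right_span (ring_center E) s x.
  by apply: (right_span_trans rC _ (e0_span x)) => y /e0P/Ps.
have Zf z : ring_center E (f z) by apply/(fP (f z)); exists z.
pose e (i : 'I_(size s)) := s`_i.
have free (w : 'I_(size s) -> Z) : \sum_i e i * f (w i) = 0 -> forall i, w i = 0.
  move=> sum0 i1; apply/eqP; apply: contraT => wi1.
  case: (arg_maxnP (fun j : 'I_(size s) => (j : nat)) (P := fun j => w j != 0) wi1).
  move=> i wi maxi; case: (cs i (ltn_ord i)).
  have fwi : f (w i) \is a GRing.unit by rewrite divE // fmorph_eq0.
  have -> : s`_i = (\sum_(j | j != i) e j * f (w j)) * - (f (w i))^-1.
    move/eqP: sum0; rewrite (bigD1 i) //= addr_eq0 => /eqP e1.
    by rewrite -[LHS](mulrK fwi) -/(e i) e1 mulrN mulNr.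
  apply: right_spanM => //.
    by rewrite -rmorphV ?unitfE // -rmorphN.
  apply: right_span_sum => // j ji; have [ltji|leij] := ltnP j i.
    apply: right_spanM => //; apply: mem_right_span => //.
    rewrite /e -(nth_take 0 ltji); apply: mem_nth.
    by rewrite size_take ltn_ord.
  have -> : w j = 0.
    apply/eqP; apply: contraT => wj; case/eqP: ji; apply: val_inj.
    by apply/eqP; rewrite eqn_leq leij andbT; apply: maxi.
  by rewrite rmorph0 mulr0; apply: right_span0.
have /choice[co hco] x : exists v : 'I_(size s) -> Z, x = \sum_i e i * f (v i).
  have [c Zc ->] := span x.
  have /choice[v hv] i : exists z, c i = f z by apply/fP.
  by exists (fun i => v (val i)); apply: eq_bigr => i _; rewrite hv.
exists Z, f, (size s), e, co; split=> // [i|v i].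
  by apply: sP; apply: mem_nth.
apply/eqP; rewrite -subr_eq0; apply/eqP.
apply: (free (fun i => co (\sum_i e i * f (v i)) i - v i)).
under eq_bigr do rewrite rmorphB mulrBr.
by rewrite sumrB -hco subrr.
Qed.

Lemma fg_spanning_has_unbounded_set (E : unitRingType) (N : set E)
    (e0 gens : seq E) (x0 y0 : E) : GRing.field_axiom E ->
  (forall x, N x -> N x^-1) -> (forall x, N x -> x != 0) ->
  (forall A : set E, A 1 -> (forall x y, A x -> A y -> A (x * y)) ->
    (forall g, g \in gens -> A g) -> N `<=` A) ->
  (forall x, x \in e0 -> N x) ->
  (forall x, right_span (ring_center E) e0 x) ->
  N x0 -> N y0 -> x0 * y0 != y0 * x0 -> has_unbounded_set N.
Proof.
move=> divE NV N0 gensP e0N e0_span Nx0 Ny0 ncom.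
have [Z [f [d [e [co [fP eN coK co_uniq]]]]]] := center_basis divE e0N e0_span.
exact: (@exists_unbounded_set E N gens divE NV N0 gensP Z f fP d e co
  eN coK co_uniq x0 y0).
Qed.

(** Products of elements of [N] stay in [N], so the central span is a ring; algebraicity makes it
    closed under inverses. *)
Lemma span_division_subring (E : unitRingType) (N : set E) :
  GRing.field_axiom E -> algebraic_over_center E -> finite_over_center E ->
  N 1 -> (forall x y, N x -> N y -> N (x * y)) ->
  exists s : seq E, [/\ forall y, y \in s -> N y,
    N `<=` right_span (ring_center E) s &
    division_subring (right_span (ring_center E) s)].
Proof.
move=> divE algE [g gspan] N1 NM; have rC := subring_ring_center E.
have [s [cs sN Ns]] := @exists_spanning_chain E (ring_center E) N (size g)
  (fun s => chain_size_center divE gspan (s := s)).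
exists s; split=> //.
have C1 : ring_center E 1 by case: rC.
have sS : subring (right_span (ring_center E) s).
  split; first exact: Ns.
    move=> x y sx sy; apply: right_spanD => //; rewrite -[y]mulr1 -mulrN.
    exact: (right_spanM rC (subringN rC C1)).
  move=> x y [c Zc ->] [c' Zc' ->]; rewrite mulr_suml; apply: right_span_sum => // i _.
  rewrite mulr_sumr; apply: right_span_sum => // j _.
  rewrite mulrA -(mulrA s`_i) (Zc i) !mulrA -(mulrA (_ * _)).
  apply: (right_spanM rC (subringM rC (Zc i) (Zc' j))).
  by apply/Ns/NM; apply/sN/mem_nth.
apply/division_subringP; split=> // x sx; apply: inverse_in_subring => // z Zz.
by rewrite -[z]mul1r; apply: right_spanM => //; apply: Ns.
Qed.

(** Reduces to the case where [N] spans: in the division ring [F] spanned by [N] over the center of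
    [E], those scalars are again central, so [N] spans [F] over the center of [F]. *)
Theorem fg_has_unbounded_set (E : unitRingType) (N : set E) (gens : seq E)
    (x0 y0 : E) :
  GRing.field_axiom E -> algebraic_over_center E -> finite_over_center E ->
  N 1 -> (forall x y, N x -> N y -> N (x * y)) ->
  (forall x, N x -> N x^-1) -> (forall x, N x -> x != 0) ->
  (forall g, g \in gens -> N g) ->
  (forall A : set E, A 1 -> (forall x y, A x -> A y -> A (x * y)) ->
    (forall g, g \in gens -> A g) -> N `<=` A) ->
  N x0 -> N y0 -> x0 * y0 != y0 * x0 -> has_unbounded_set N.
Proof.
move=> divE algE finE N1 NM NV N0 gN gensP Nx0 Ny0 ncom.
have [s [sN Ns dS]] := span_division_subring divE algE finE N1 NM.
have [F [f [divF fP]]] := division_subring_type divE dS.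
have finj : injective f := @division_rmorph_inj _ _ f divF.
have Nf x : N x -> exists a, x = f a by move=> /Ns/fP.
apply: (has_unbounded_set_image divF Nf).
have [gens' eg] := rmorph_lift_seq (fun g gg => Nf g (gN g gg)).
have [s' es] := rmorph_lift_seq (fun y ys => Nf y (sN y ys)).
have [a0 ea0] := Nf _ Nx0; have [b0 eb0] := Nf _ Ny0.
apply: (@fg_spanning_has_unbounded_set F _ s' gens' a0 b0) => //=.
- move=> x Nx; have x0' : x != 0.
    by apply: contra_neq (N0 _ Nx) => ->; rewrite rmorph0.
  by rewrite rmorphV ?divF //; apply: NV.
- by move=> x Nx; apply: contra_neq (N0 _ Nx) => ->; rewrite rmorph0.
- move=> A A1 AM gA x Nx.
  have [a Aa /finj ->//] : [set y | exists2 a, A a & y = f a] (f x).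
  apply: gensP Nx.
  + by exists 1; rewrite ?rmorph1.
  + by move=> _ _ [a Aa ->] [b Ab ->]; exists (a * b); [apply: AM|rewrite rmorphM].
  + by move=> g; rewrite eg => /mapP[a ag ->]; exists a => //; apply: gA.
- by move=> x xs'; apply: sN; rewrite es; apply: map_f.
- move=> x; have [c Zc ec] : right_span (ring_center E) s (f x) by apply/fP; exists x.
  have /choice[b hb] i : exists b, ring_center F b /\ c i = f b.
    have [|b eb] := (fP (c i)).1.
      rewrite -[c i]mul1r; apply: right_spanM => //; first exact: subring_ring_center.
      exact: Ns.
    exists b; split=> // y; apply: finj; rewrite !rmorphM /= -eb; exact: Zc.
  exists b; first by move=> i; case: (hb i).
  apply: finj; rewrite ec rmorph_sum es size_map; apply: eq_bigr => i _.
  by rewrite (nth_map 0) // rmorphM /= -(hb i).2.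
- by rewrite -ea0.
- by rewrite -eb0.
- by apply: contra_neq ncom => e; rewrite ea0 eb0 -!rmorphM e.
Qed.

(** * Subnormal subgroups *)

Section SubnormalSubgroups.
Variable G : groupType.
Implicit Types (H K X A : set G) (x y g h k : G).

Lemma subgroupP H : subgroup H <->
  [/\ H 1%g, forall x y, H x -> H y -> H (x * y)%g & forall x, H x -> H x^-1%g].
Proof.
split=> [sH|[H1 HM HV]].
  have HM := group_closedM sH; have HV := group_closedV sH.
  split=> [|x y Hx Hy|x Hx]; apply: set_mem; first by case: sH.
    by apply: HM; apply: mem_set.
  by apply: HV; apply: mem_set.
split; first exact: mem_set.
by move=> x y /set_mem Hx /set_mem Hy; apply: mem_set; apply: HM => //; apply: HV.
Qed.

Lemma subgroup_generated X : subgroup (generated_subgroup X).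
Proof.
apply/subgroupP; split=> [|x y Hx Hy|x Hx] H [sH XH];
  have [H1 HM HV] := (subgroupP H).1 sH => //.
- by apply: HM; [apply: Hx|apply: Hy].
- by apply: HV; apply: Hx.
Qed.

Lemma sub_generated X : X `<=` generated_subgroup X.
Proof. exact: sub_gen_smallest. Qed.

Lemma generated_sub X H : subgroup H -> X `<=` H -> generated_subgroup X `<=` H.
Proof. exact: smallest_sub. Qed.

Lemma normal_generated X K : subgroup K -> X `<=` K ->
  (forall x k, X x -> K k -> X (x ^ k)%g) -> normal_in (generated_subgroup X) K.
Proof.
move=> sK XK Xk; split=> //; first exact: subgroup_generated.
  exact: generated_sub.
move=> h k /set_mem Xh /set_mem Kk; apply: mem_set.
pose H : set G := [set g | generated_subgroup X (g ^ k)%g].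
have [X1 XM XV] := (subgroupP _).1 (subgroup_generated X).
suff: generated_subgroup X `<=` H by apply.
apply: generated_sub; last first.
  by move=> x Xx; apply: sub_generated; apply: Xk.
apply/subgroupP; split; first by rewrite /H /= conj1g.
- by move=> x y Hx Hy; rewrite /H /= conjMg; apply: XM.
- by move=> x Hx; rewrite /H /= conjVg; apply: XV.
Qed.

Lemma generated_commute X : (forall x y, X x -> X y -> commute x y) ->
  forall x y, generated_subgroup X x -> generated_subgroup X y -> commute x y.
Proof.
have cent Y : subgroup [set g | forall y, Y y -> commute g y].
  apply/subgroupP; split=> [y _|x y cx cy z Yz|x cx y Yy] /=.
  - exact/commute_sym/commute1.
  - by apply/commute_sym/commuteM; apply: commute_sym; [apply: cx|apply: cy].
  - by apply/commute_sym/commuteV/commute_sym/cx.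
move=> comX x y Xx Xy.
have XX z : X z -> forall w, generated_subgroup X w -> commute w z.
  move=> Xz w Xw; have := generated_sub (cent [set z]) (X := X).
  by move=> /(_ _ w Xw z erefl); apply=> v Xv _ ->; apply: comX.
have := generated_sub (cent (generated_subgroup X)) (X := X).
by apply=> // z Xz w Xw; apply: commute_sym; apply: XX.
Qed.

Lemma normalJ H K h k : normal_in H K -> H h -> K k -> H (h ^ k)%g.
Proof.
by move=> [_ _ _ nHK] Hh Kk; apply: set_mem; apply: nHK; apply: mem_set.
Qed.

Lemma subnormal_cons (C : nat -> set G) r H i : (i <= r)%N ->
  C r = [set: G] -> (forall i, (i < r)%N -> normal_in (C i) (C i.+1)) ->
  normal_in H (C i) -> subnormal H.
Proof.
move=> ir Cr nC nH; exists (r - i).+1, (fun j => if j is j'.+1 then C (i + j')%N else H).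
split=> //=; first by rewrite subnKC.
move=> [|j]; first by rewrite addn0.
by rewrite ltnS addnS ltn_subRL => ?; apply: nC.
Qed.

(** Descend from the whole group: for g in [U] and in one term of the chain, the conjugate of x in
    [H] by g^-1 lies in the next smaller term by normality, and in [U] for the chosen x. *)
Lemma subnormal_meet_conj_stable H U : subnormal H -> (exists g, U g) ->
  (forall g, U g -> exists2 x, H x & U (x ^ g^-1)%g) -> exists2 g, H g & U g.
Proof.
move=> [r [C [C0 Cr nC]]] [g0 Ug0] UJ; rewrite -C0.
have HC i : (i <= r)%N -> H `<=` C i.
  elim: i => [|i IH] ir; first by rewrite C0.
  by apply: subset_trans (IH (ltnW ir)) _; case: (nC i ir).
suff: forall i, (i <= r)%N -> exists2 g, C (r - i)%N g & U g.
  by move=> /(_ r (leqnn r)); rewrite subnn.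
elim=> [|i IH] ir; first by rewrite subn0 Cr; exists g0.
have [g Cg Ug] := IH (ltnW ir); have [x Hx Uxg] := UJ g Ug.
exists (x ^ g^-1)%g => //.
have lt : (r - i.+1 < r)%N by rewrite ltn_subrL ltn0Sn (leq_ltn_trans _ ir).
apply: (normalJ (nC _ lt)); first by apply: HC => //; apply: ltnW.
rewrite subnSK //.
have [_ sC _ _] := nC _ lt; rewrite subnSK // in sC.
by case/subgroupP: sC => _ _; apply.
Qed.

Section AbelianSubnormal.
Hypothesis fg_commute : forall H, subnormal H -> finitely_generated H ->
  forall x y, H x -> H y -> commute x y.
Hypothesis finite_classes : forall A K, normal_in A K ->
  (forall x y, A x -> A y -> commute x y) ->
  forall x, A x -> finite_set [set (x ^ k)%g | k in K].
Hypothesis abelian_normal_central : forall A, normal_in A [set: G] ->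
  (forall x y, A x -> A y -> commute x y) ->
  forall x g, A x -> commute x g.

(** Induction on the depth: [A] is replaced by its normal closure in [C 2], of depth one less. Two
    conjugates a^g and b^h commute because their [C 1]-classes are finite and generate a finitely
    generated normal subgroup of [C 1], which is subnormal. *)
Lemma abelian_subnormal_central A : subnormal A ->
  (forall x y, A x -> A y -> commute x y) -> forall x g, A x -> commute x g.
Proof.
move=> [r]; elim: r A => [|[|r] IH] A [C [C0 Cr nC]] comA.
- by move=> x g Ax; apply: comA => //; rewrite -C0 Cr.
- by apply: abelian_normal_central => //; rewrite -C0 -Cr; apply: nC.
have nA1 : normal_in A (C 1%N) by rewrite -C0; apply: nC.
have n12 : normal_in (C 1%N) (C 2%N) by apply: nC.
have [sA s1 A1 _] := nA1; have [_ s2 C12 _] := n12.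
have [_ C2M C2V] := (subgroupP _).1 s2.
pose X := [set x | exists2 a, A a & exists2 g, C 2%N g & x = (a ^ g)%g].
have X1 : X `<=` C 1%N.
  by move=> _ [a Aa [g Cg ->]]; apply: (normalJ n12) => //; apply: A1.
have nB : normal_in (generated_subgroup X) (C 2%N).
  apply: normal_generated => //; first exact: subset_trans X1 C12.
  move=> _ k [a Aa [g Cg ->]] Ck; exists a => //.
  by exists (g * k)%g; [apply: C2M|rewrite conjgM].
have AB : A `<=` generated_subgroup X.
  move=> a Aa; apply: sub_generated; exists a => //; exists 1%g.
    by case/subgroupP: s2.
  by rewrite conjg1.
suff comB x y : generated_subgroup X x -> generated_subgroup X y -> commute x y.
  have chainB : exists C0, [/\ C0 0%N = generated_subgroup X, C0 r.+1 = [set: G] &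
      forall i, (i < r.+1)%N -> normal_in (C0 i) (C0 i.+1)].
    exists (fun i => if i is j.+1 then C j.+2 else generated_subgroup X).
    split=> // -[|i] ir //; exact: nC.
  by move=> x g Ax; apply: (IH _ chainB comB); apply: AB.
apply: generated_commute => {x y} _ _ [a Aa [g Cg ->]] [b Ab [h Ch ->]].
pose cl a g := [set ((a ^ g) ^ k)%g | k in C 1%N].
have conjC g' k : C 2%N g' -> C 1%N k -> C 1%N (g' * k * g'^-1)%g.
  move=> Cg' Ck; have -> : (g' * k * g'^-1 = k ^ g'^-1)%g.
    by rewrite /conjg invgK mulgA.
  by apply: (normalJ n12) => //; apply: C2V.
(* As [C 1] is normal in [C 2], conjugation by g' carries the [C 1]-class of a' onto that of its
   conjugate. *)
have fin_cl a' g' : A a' -> C 2%N g' -> finite_set (cl a' g').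
  move=> Aa' Cg'.
  apply: sub_finite_set (finite_image (fun x => x ^ g')%g
    (finite_classes nA1 comA Aa')).
  move=> _ [k Ck <-]; exists (a' ^ (g' * k * g'^-1))%g.
    by exists (g' * k * g'^-1)%g => //; apply: conjC.
  by rewrite -!conjgM mulgVK.
pose Y := cl a g `|` cl b h.
have cl1 a' g' : C 1%N 1%g -> cl a' g' (a' ^ g')%g.
  by exists 1%g; rewrite ?conjg1.
have [C11 C1M C1V] := (subgroupP _).1 s1.
have C1J x k : C 1%N x -> C 1%N k -> C 1%N (x ^ k)%g.
  by move=> Cx Ck; exact: C1M (C1V _ Ck) (C1M _ _ Cx Ck).
have nY : normal_in (generated_subgroup Y) (C 1%N).
  apply: normal_generated => //.
    move=> x [] [k Ck <-]; apply: C1J => //; apply: X1.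
      by exists a => //; exists g.
    by exists b => //; exists h.
  move=> x k [] [l Cl <-] Ck; [left|right]; exists (l * k)%g;
    by [apply: C1M|rewrite conjgM].
apply: (fg_commute (H := generated_subgroup Y)).
- exact: (subnormal_cons (r := r.+2) (i := 1) _ Cr nC).
- exists Y => //; rewrite finite_setU; split; exact: fin_cl.
- by apply: sub_generated; left; apply: cl1.
- by apply: sub_generated; right; apply: cl1.
Qed.

End AbelianSubnormal.
End SubnormalSubgroups.

Section GeneratingSequence.
Variables (R : nzRingType) (G : groupType) (u : G -> R).
Hypothesis uM : {morph u : g h / (g * h)%g >-> g * h}.
Hypothesis u1 : u 1%g = 1.

(** Inverses of the generators are listed too, so that [H] is generated as a monoid and closure
    under products suffices. *)
Lemma finitely_generated_seq (H : set G) : finitely_generated H ->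
  exists gens : seq R, (forall x, x \in gens -> exists2 g, H g & x = u g) /\
    forall A : set R, A 1 -> (forall x y, A x -> A y -> A (x * y)) ->
      (forall z, z \in gens -> A z) -> forall g, H g -> A (u g).
Proof.
move=> [X /finite_seqP[s ->] ->].
have [H1 HM HV] := (subgroupP _).1 (subgroup_generated [set` s]).
have sH g : g \in s -> generated_subgroup [set` s] g.
  by move=> gs; apply: sub_generated.
exists ([seq u g | g <- s] ++ [seq u g^-1%g | g <- s]); split.
  move=> x; rewrite mem_cat => /orP[] /mapP[g gs ->].
    by exists g => //; apply: sH.
  by exists g^-1%g => //; apply: HV; apply: sH.
move=> A A1 AM As g Hg; suff: A (u g) /\ A (u g^-1%g) by case.
pose B : set G := [set g | A (u g) /\ A (u g^-1%g)].
suff: generated_subgroup [set` s] `<=` B by apply.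
apply: generated_sub.
  apply/subgroupP; split=> [|x y [Ax Ax'] [Ay Ay']|x [Ax Ax']].
  - by rewrite /B /= invg1 u1.
  - by rewrite /B /= invgM !uM; split; apply: (AM).
  - by rewrite /B /= invgK.
move=> x xs; split; apply: As; rewrite mem_cat; apply/orP; [left|right];
  by apply/mapP; exists x.
Qed.

End GeneratingSequence.

(** * Subnormal subgroups of the multiplicative group of D *)

Section MultiplicativeGroup.
Variables (D : unitRingType) (G : groupType) (u : G -> D).
Hypothesis divD : GRing.field_axiom D.
Hypothesis saD : strongly_algebraic D.
Hypothesis uM : {morph u : g h / (g * h)%g >-> g * h}.
Hypothesis u1 : u 1%g = 1.
Hypothesis uinj : injective u.
Hypothesis usurj : forall x, x != 0 -> exists g, x = u g.
Implicit Types (H K A : set G) (g h k : G).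

Let u_unit g : u g \is a GRing.unit.
Proof. by apply/unitrP; exists (u g^-1%g); rewrite -!uM mulVg mulgV u1. Qed.

Let u0 g : u g != 0.
Proof. by apply/eqP => e; have := u_unit g; rewrite e unitr0. Qed.

Let uV g : u g^-1%g = (u g)^-1.
Proof. by apply: (mulrI (u_unit g)); rewrite -uM mulgV u1 divrr. Qed.

Let uJ g k : u (g ^ k)%g = (u k)^-1 * u g * u k.
Proof. by rewrite /conjg !uM uV mulrA. Qed.

Let ucommute g h : u g * u h = u h * u g -> commute g h.
Proof. by rewrite -!uM => /uinj. Qed.

(** The generators live in a division ring finite over its center. A noncommuting pair would yield
    an unbounded set there, whose image in [D] contradicts subnormality. *)
Lemma fg_subnormal_commute H : subnormal H -> finitely_generated H ->
  forall x y, H x -> H y -> commute x y.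
Proof.
move=> snH fgH x y Hx Hy; apply: contrapT => ncom.
have sH : subgroup H.
  by case: fgH => X _ ->; apply: subgroup_generated.
have [H1 HM HV] := (subgroupP H).1 sH.
have [gens [gH gensP]] := finitely_generated_seq uM u1 fgH.
have [E [f [divE algE finE fgens]]] := finite_over_center_cover gens divD saD.
have finj := @division_rmorph_inj _ _ f divE.
pose N : set D := [set z | exists2 g, H g & z = u g].
have Nf z : N z -> exists a, z = f a.
  move=> [g Hg ->]; apply: (gensP [set z | exists a, z = f a]) => //.
  - by exists 1; rewrite rmorph1.
  - by move=> _ _ [a ->] [b ->]; exists (a * b); rewrite rmorphM.
suff [U [[a Ua] U0 Uconj UN]] : has_unbounded_set N.
  have [|g Ug|g Hg Ug] := subnormal_meet_conj_stable
      (U := [set g | U (u g)]) snH.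
  - by have [g eg] := usurj (U0 a Ua); exists g; rewrite /= -eg.
  - have [_ [[h Hh ->] Uh]] := Uconj _ Ug; exists h => //=.
    by rewrite uJ uV invrK.
  - by apply: (UN (u g)) => //; exists g.
apply: (has_unbounded_set_image divE Nf).
have [gens' eg] := rmorph_lift_seq fgens.
have [a ea] := Nf (u x) (ex_intro2 _ _ x Hx erefl).
have [b eb] := Nf (u y) (ex_intro2 _ _ y Hy erefl).
apply: (@fg_has_unbounded_set E _ gens' a b) => //=.
- by rewrite rmorph1; exists 1%g.
- move=> c d [g Hg e] [h Hh e']; exists (g * h)%g; first exact: HM.
  by rewrite rmorphM e e' uM.
- move=> c [g Hg e]; exists g^-1%g; first exact: HV.
  rewrite uV -e rmorphV // divE //.
  by apply: contra_neq (u0 g) => c0; rewrite -e c0 rmorph0.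
- by move=> c [g Hg e]; apply: contra_neq (u0 g) => c0; rewrite -e c0 rmorph0.
- by move=> c cg; apply: gH; rewrite eg; apply: map_f.
- move=> A A1 AM gA c [g Hg e].
  have [d Ad ed] : [set z | exists2 a, A a & z = f a] (u g).
    apply: gensP => //.
    + by exists 1; rewrite ?rmorph1.
    + by move=> _ _ [d Ad ->] [d' Ad' ->]; exists (d * d'); [apply: AM|rewrite rmorphM].
    + by move=> z; rewrite eg => /mapP[d dg ->]; exists d => //; apply: gA.
  by rewrite (finj c d) // e.
- by rewrite -ea; exists x.
- by rewrite -eb; exists y.
- apply/eqP => e; apply: ncom; apply: ucommute.
  by rewrite ea eb -!rmorphM e.
Qed.

(* Conjugates of x lying in a commutative subgroup are commuting roots of the
   minimal polynomial of x over the center. *)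
Lemma finite_classes A K : normal_in A K ->
  (forall x y, A x -> A y -> commute x y) ->
  forall x, A x -> finite_set [set (x ^ k)%g | k in K].
Proof.
move=> nAK comA x Ax; have [p [p0 Fp px]] := saD.1 (u x).
apply: contrapT => /(infinite_set_fset (size p))[B BS].
have := finmap.fset_uniq B; set s := finmap.enum_fset B => us.
have {}BS y : y \in s -> exists2 k, K k & (x ^ k)%g = y by move=> /BS.
apply/negP; rewrite -ltnNge -(size_map u s); apply: max_ring_poly_roots => //.
  apply/allP => _ /mapP[y yB ->]; have [k Kk <-] := BS y yB.
  apply/rootP; rewrite uJ; move/rootP: px => px.
  have conj_horner : p.[(u k)^-1 * u x * u k] = (u k)^-1 * p.[u x] * u k.
    rewrite !horner_coef mulr_sumr mulr_suml; apply: eq_bigr => i _.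
    have Zi : ring_center D p`_i.
      by move/(all_nthP 0): Fp => /(_ i (ltn_ord i)) /set_mem.
    have -> : ((u k)^-1 * u x * u k) ^+ i = (u k)^-1 * u x ^+ i * u k.
      elim: (nat_of_ord i) => [|j IH]; first by rewrite !expr0 mulr1 mulVr.
      by rewrite !exprS IH !mulrA mulrK.
    by rewrite !mulrA (Zi (u k)^-1).
  by rewrite conj_horner px mulr0 mul0r.
have Bcom y : y \in s -> A y.
  by move=> /BS[k Kk <-]; apply: (normalJ nAK).
(* The bound on the number of roots asks that the roots commute pairwise and have invertible
   differences. *)
elim: s us Bcom {BS} => //= y s IH /andP[ys us] Bcom; rewrite IH // ?andbT; last first.
  by move=> z zs; apply: Bcom; rewrite inE zs orbT.
apply/allP => _ /mapP[z zs ->]; rewrite /diff_roots -!uM.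
rewrite (comA y z) ?eqxx /=; last 2 first.
- by apply: Bcom; rewrite inE eqxx.
- by apply: Bcom; rewrite inE zs orbT.
apply: divD; rewrite subr_eq0; apply/eqP => /uinj ezy.
by rewrite -ezy zs in ys.
Qed.

(** Compare conjugation by g and by 1 + g: from (1 + g) x = x1 (1 + g) and g x = x2 g follows (x1 -
    x2) g = x - x1. Either g is a quotient of elements commuting with x, or x = x1 = x2 and g x = x
    g. *)
Lemma abelian_normal_central A : normal_in A [set: G] ->
  (forall x y, A x -> A y -> commute x y) -> forall x g, A x -> commute x g.
Proof.
move=> nA comA x g Ax; apply: ucommute.
have [y0|y0] := eqVneq (1 + u g) 0.
  have -> : u g = -1 by apply/eqP; rewrite -addr_eq0 addrC y0.
  by rewrite mulrN1 mulN1r.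
have [h eh] := usurj y0.
have conjA k : exists2 z, A z & u k * u x = u z * u k.
  exists (x ^ k^-1)%g; first exact: (normalJ nA).
  by rewrite -!uM /conjg invgK -!mulgA mulVg mulg1.
have [x1 Ax1 e1] := conjA h; have [x2 Ax2 e2] := conjA g.
have e : (u x1 - u x2) * u g = u x - u x1.
  move: e1; rewrite -eh mulrDl mulrDr mul1r mulr1 e2 => e1.
  by apply/eqP; rewrite mulrBl subr_eq addrAC eq_sym subr_eq e1 addrC.
have [d0|d0] := eqVneq (u x1 - u x2) 0.
  have /subr0_eq ex1 : u x - u x1 = 0 by rewrite -e d0 mul0r.
  by move/subr0_eq: d0 e2 => d0 ->; rewrite ex1 d0.
have com a b : A a -> A b -> GRing.comm (u a) (u b).
  by move=> Aa Ab; rewrite /GRing.comm -!uM comA.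
have -> : u g = (u x1 - u x2)^-1 * (u x - u x1) by rewrite -e mulKr ?divD.
by apply: commrM; [apply: commrV|]; apply: commrB => //; apply: com.
Qed.

Theorem fg_subnormal_central H : subnormal H -> finitely_generated H ->
  forall g, H g -> ring_center D (u g).
Proof.
move=> snH fgH g Hg x; have [->|/usurj[h ->]] := eqVneq x 0.
  exact: commr0.
suff : commute g h by rewrite /GRing.comm -!uM => ->.
apply: (abelian_subnormal_central fg_subnormal_commute finite_classes
  abelian_normal_central snH) => //; exact: fg_subnormal_commute.
Qed.

End MultiplicativeGroup.

(** * Conjugates by transvections *)

Section Transvections.
Variables (D : unitRingType) (divD : GRing.field_axiom D) (m : nat).
Let n := m.+2.
Implicit Types (X : 'M[D]_n) (p q : 'cV[D]_n) (v : 'rV[D]_n) (c d : D).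

Lemma mul_col_scalar p c k : (p *m (c%:M : 'M_1)) k 0 = p k 0 * c.
Proof. by rewrite mxE big_ord1 mxE eqxx mulr1n. Qed.

(** Testing e_i + e_j c with i != j gives d_j c = c d_i for the eigenvalues. With c = 1 they all
    agree, and then their common value is central; a second index exists since the size is at least
    2. *)
Lemma scalar_of_eigenvectors X :
  (forall p, exists c, X *m p = p *m (c%:M : 'M_1)) ->
  exists2 a, ring_center D a & X = a%:M.
Proof.
move=> eig; pose e i : 'cV[D]_n := delta_mx i 0.
have /choice[d Xd] i := eig (e i).
have ee i k c : (e i *m (c%:M : 'M_1)) k 0 = (k == i)%:R * c.
  by rewrite mul_col_scalar mxE eqxx andbT.
have key i j c : i != j -> d j * c = c * d i.
  move=> ij; have [b eb] := eig (e i + e j *m (c%:M : 'M_1)).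
  move: eb; rewrite mulmxDr mulmxA !Xd mulmxDl => eb.
  have {}eb k : (k == i)%:R * d i + (k == j)%:R * d j * c =
      (k == i)%:R * b + (k == j)%:R * c * b.
    have := congr1 (fun M : 'cV[D]_n => M k 0) eb.
    rewrite /= mxE ee mul_col_scalar ee => ->.
    by rewrite mxE ee mul_col_scalar ee.
  move: (eb i) (eb j); rewrite !eqxx (negPf ij) [j == i]eq_sym (negPf ij).
  by rewrite !mul0r !mul1r !addr0 !add0r => ->.
have other (i : 'I_n) : exists j : 'I_n, i != j.
  by exists (if i == 0 then 1 else 0); case: ifP => [/eqP ->|/negbT].
have dE i j : d i = d j.
  have [->//|ij] := eqVneq i j.
  by have := key i j 1 ij; rewrite mulr1 mul1r.
exists (d 0).
  move=> c; have [j j0] := other 0; have := key _ _ c j0.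
  by rewrite (dE j 0).
apply/matrixP => i j; have := congr1 (fun M : 'cV[D]_n => M i 0) (Xd j).
rewrite /= -colE mxE ee => ->; rewrite mxE (dE j 0).
by case: eqP; rewrite ?mul1r ?mul0r ?mulr1n ?mulr0n.
Qed.

(** With p_k nonzero, the rows e_j - p_j p_k^-1 e_k kill p, and they all kill q only if q = p
    (p_k^-1 q_k). *)
Lemma separating_row p q : p != 0 -> (forall c, q != p *m (c%:M : 'M_1)) ->
  exists2 v : 'rV[D]_n, (v *m p) 0 0 = 0 & (v *m q) 0 0 != 0.
Proof.
move=> p0 qp; have [k pk] : exists k, p k 0 != 0.
  apply: contrapT => no; case/eqP: p0; apply/colP => k; rewrite mxE.
  by apply/eqP; apply: contrapT => /negP pk; apply: no; exists k.
pose v j : 'rV[D]_n := delta_mx 0 j - (p j 0 * (p k 0)^-1) *: delta_mx 0 k.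
have vE j q' : (v j *m q') 0 0 = q' j 0 - p j 0 * (p k 0)^-1 * q' k 0.
  by rewrite mulmxBl -scalemxAl -!rowE !mxE.
have [j vj] : exists j, (v j *m q) 0 0 != 0.
  apply: contrapT => no; case/eqP: (qp ((p k 0)^-1 * q k 0)).
  apply/colP => j; rewrite mul_col_scalar mulrA.
  apply/eqP; rewrite -subr_eq0 -vE; apply: contrapT => /negP vj.
  by apply: no; exists j.
by exists (v j) => //; rewrite vE mulrVK ?divD // subrr.
Qed.

Lemma separating_row2 p q q' : p != 0 ->
  (forall c, q != p *m (c%:M : 'M_1)) -> (forall c, q' != p *m (c%:M : 'M_1)) ->
  exists v : 'rV[D]_n, [/\ (v *m p) 0 0 = 0, (v *m q) 0 0 != 0 & (v *m q') 0 0 != 0].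
Proof.
move=> p0 /(separating_row p0)[v vp vq] /(separating_row p0)[w wp wq].
have [vq'|vq'] := eqVneq ((v *m q') 0 0) 0; last by exists v.
have [wq'|wq'] := eqVneq ((w *m q) 0 0) 0; last by exists w.
have addE r : ((v + w) *m r) 0 0 = (v *m r) 0 0 + (w *m r) 0 0 by rewrite mulmxDl mxE.
by exists (v + w); rewrite !addE vp wp vq' wq' !(addr0, add0r).
Qed.

(** Some column p is not an eigenvector of [X], hence not of its inverse either; a row killing p can
    be chosen to kill neither image of p. *)
Lemma transvection_data X Xi : X *m Xi = 1%:M -> Xi *m X = 1%:M ->
  ~ (exists2 a, ring_center D a & X = a%:M) ->
  exists (p : 'cV[D]_n) (v : 'rV[D]_n), [/\ p != 0, (v *m p) 0 0 = 0, (v *m X *m p) 0 0 != 0 &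
    (v *m Xi *m p) 0 0 != 0].
Proof.
move=> XXi XiX /(contra_not (@scalar_of_eigenvectors X))/existsNP[p noc].
have p0 : p != 0.
  apply/eqP => p0; apply: noc; exists 0; by rewrite p0 mulmx0 mul0mx.
have Xp c : X *m p != p *m (c%:M : 'M_1).
  by apply/eqP => e; apply: noc; exists c.
have Xip c : Xi *m p != p *m (c%:M : 'M_1).
  apply/eqP => e; have e1 : p = X *m p *m (c%:M : 'M_1).
    by rewrite -mulmxA -e mulmxA XXi mul1mx.
  have [c0|c0] := eqVneq c 0.
    by case/eqP: p0; rewrite e1 c0 raddf0 mulmx0.
  case/eqP: (Xp c^-1); rewrite {2}e1 -mulmxA -scalar_mxM mulrV ?divD //.
  by rewrite mulmx1.
have [v [vp vX vXi]] := separating_row2 p0 Xp Xip.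
by exists p, v; rewrite -!mulmxA.
Qed.

End Transvections.

(** * Iterated conjugates of a transvection as polynomials in its parameter *)

Section ConjugationPolynomials.
Variables (E : unitRingType) (divE : GRing.field_axiom E) (m : nat).
Let n := m.+2.
Variables (X Xi : 'M[E]_n) (p : 'cV[E]_n) (v : 'rV[E]_n).
Hypotheses (p0 : p != 0) (vp : (v *m p) 0 0 = 0).
Hypotheses (vX : (v *m X *m p) 0 0 != 0) (vXi : (v *m Xi *m p) 0 0 != 0).

(* With a = 1 + t p v and its inverse 1 - t p v, the pair at stage r gives
   w_r and its inverse as polynomials in t, where w_0 = a and w_(r+1) is the
   conjugate w_r x w_r^-1. *)
Fixpoint conj_poly r : {poly 'M[E]_n} * {poly 'M[E]_n} :=
  if r is r'.+1 then
    let: (W, W') := conj_poly r' in (W * X%:P * W', W * Xi%:P * W')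
  else ((p *m v)%:P * 'X + 1, (- (p *m v))%:P * 'X + 1).

Let rank1 d : 'M[E]_n := p *m (d%:M : 'M_1) *m v.

Let rank1_neq0 d : d != 0 -> rank1 d != 0.
Proof.
move=> d0; have nz k l (A : 'M[E]_(k, l)) : A != 0 -> exists i j, A i j != 0.
  move=> A0; apply: contrapT => no; case/eqP: A0; apply/matrixP => i j.
  rewrite mxE; apply/eqP; apply: contrapT => /negP Aij.
  by apply: no; exists i, j.
have [i [j pij]] := nz _ _ _ p0; rewrite [j]ord1 in pij.
have v0 : v != 0.
  by apply: contra_neq vX => ->; rewrite !mul0mx mxE.
have [i' [j' vij]] := nz _ _ _ v0; rewrite [i']ord1 in vij.
have mul0 (a b : E) : a != 0 -> b != 0 -> a * b != 0.
  move=> a0 b0; apply/eqP => ab; case/eqP: b0.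
  by rewrite -(mulKr (divE a0) b) ab mulr0.
apply/eqP => /matrixP/(_ i j'); rewrite mxE big_ord1 mul_col_scalar mxE.
by apply/eqP; apply: (mul0) => //; apply: (mul0).
Qed.

Let rank1_mul d (A : 'M[E]_n) d' :
  rank1 d * A * rank1 d' = rank1 (d * (v *m A *m p) 0 0 * d').
Proof.
by rewrite /rank1 !scalar_mxM -(mx11_scalar (v *m A *m p)) -!mulmxE !mulmxA.
Qed.

(** Leading coefficients have the form p d v, and (p d v) A (p d' v) = p (d (v A p) d') v. For A =
    [X] and A = [Xi] the scalar v A p is nonzero, so leading terms never cancel. *)
Lemma conj_poly_lead r : exists d d', [/\ d != 0, d' != 0,
  lead_coef (conj_poly r).1 = rank1 d, lead_coef (conj_poly r).2 = rank1 d' &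
  (1 < size (conj_poly r).1)%N /\ (1 < size (conj_poly r).2)%N].
Proof.
have mul0 (a b : E) : a != 0 -> b != 0 -> a * b != 0.
  move=> a0 b0; apply/eqP => ab; case/eqP: b0.
  by rewrite -(mulKr (divE a0) b) ab mulr0.
elim: r => [|r [d [d' [d0 d'0]]]] /=.
  have lin (A : 'M[E]_n) : A != 0 -> lead_coef (A%:P * 'X + 1) = A /\
      size (A%:P * 'X + 1) = 2.
    move=> A0; have szA : size (A%:P * 'X) = 2.
      by rewrite size_mulX ?polyC_eq0 // size_polyC A0.
    rewrite lead_coefDl ?size_polyDl ?szA ?size_poly1 //.
    by rewrite lead_coefMX lead_coefC.
  have r1 : rank1 1 = p *m v by rewrite /rank1 mulmx1.
  have rN1 : rank1 (-1) = - (p *m v).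
    by rewrite /rank1 raddfN /= mulmxN mulmx1 mulNmx.
  have [|l s] := lin (p *m v); first by rewrite -r1 rank1_neq0 ?oner_eq0.
  have [|l' s'] := lin (- (p *m v)).
    by rewrite -rN1 rank1_neq0 // oppr_eq0 oner_eq0.
  exists 1, (-1); rewrite oppr_eq0 oner_eq0 l l' s s' r1 rN1; split=> //.
case: (conj_poly r) => W W' /= lW lW' [sW sW'].
have step (A : 'M[E]_n) : (v *m A *m p) 0 0 != 0 ->
    lead_coef (W * A%:P * W') = rank1 (d * (v *m A *m p) 0 0 * d') /\
    (1 < size (W * A%:P * W')%R)%N.
  move=> A0; have nz : rank1 d * A * rank1 d' != 0.
    by rewrite rank1_mul; apply: rank1_neq0; do 2?apply: (mul0).
  have nz1 : lead_coef W * lead_coef A%:P != 0.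
    by rewrite lW lead_coefC; apply: contra_neq nz => ->; rewrite mul0r.
  have l1 := lead_coef_proper_mul nz1.
  have nz2 : lead_coef (W * A%:P) * lead_coef W' != 0.
    by rewrite l1 lW lW' lead_coefC.
  rewrite lead_coef_proper_mul // l1 lW lW' lead_coefC rank1_mul; split=> //.
  rewrite size_proper_mul //.
  have : (0 < size (W * A%:P)%R)%N.
    rewrite size_poly_gt0 -lead_coef_eq0; apply: contra_neq nz2 => ->.
    by rewrite mul0r.
  case: (size (W * A%:P)%R) => // a _.
  by case: (size W') sW' => [|[|b]] // _; rewrite !addSn !addnS.
have [l s] := step X vX; have [l' s'] := step Xi vXi.
exists (d * (v *m X *m p) 0 0 * d'), (d * (v *m Xi *m p) 0 0 * d'); split=> //.
- by do 2?apply: (mul0).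
- by do 2?apply: (mul0).
Qed.

Lemma central_scalar_comm t (A : 'M[E]_n) : ring_center E t ->
  A * t%:M = t%:M * A.
Proof.
move=> Zt; rewrite -!mulmxE mul_scalar_mx; apply/matrixP => i j.
rewrite !mxE (bigD1 j) //= big1 ?addr0 => [|k kj]; rewrite mxE.
  by rewrite eqxx mulr1n; apply/esym; apply: Zt.
by rewrite (negPf kj) mulr0n mulr0.
Qed.

Lemma conj_poly_horner r t : ring_center E t ->
  (conj_poly r.+1).1.[t%:M] = (conj_poly r).1.[t%:M] * X * (conj_poly r).2.[t%:M] /\
  (conj_poly r.+1).2.[t%:M] = (conj_poly r).1.[t%:M] * Xi * (conj_poly r).2.[t%:M].
Proof.
move=> Zt /=; case: (conj_poly r) => W W' /=.
have comt (q : {poly 'M[E]_n}) : comm_poly q t%:M.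
  by apply: comm_coef_poly => i; apply: central_scalar_comm.
by rewrite !hornerM_comm // !hornerC.
Qed.

Lemma conj_poly0_inverse t : ring_center E t ->
  (conj_poly 0).1.[t%:M] * (conj_poly 0).2.[t%:M] = 1 /\
  (conj_poly 0).2.[t%:M] * (conj_poly 0).1.[t%:M] = 1.
Proof.
move=> Zt /=; rewrite !hornerMXaddC !hornerC.
have vp0 : v *m p = 0.
  by apply/matrixP => i j; rewrite !ord1 vp mxE.
have com := central_scalar_comm (p *m v) Zt.
have pvpv : (p *m v : 'M[E]_n) * (p *m v) = 0.
  by rewrite -[LHS]/((p *m v) *m (p *m v)) -mulmxA (mulmxA v) vp0 mul0mx mulmx0.
have sq : (p *m v) * t%:M * ((p *m v) * t%:M) = 0.
  by rewrite {1}com -mulrA (mulrA (p *m v)) pvpv mul0r mulr0.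
rewrite mulNr.
by rewrite !(mulrDl, mulrDr, mulrN, mulNr, mul1r, mulr1) sq oppr0 !add0r addKr addNKr.
Qed.

End ConjugationPolynomials.

(** * Matrices of size at least two *)

Lemma subnormal_iter_conj (G : groupType) (H : set G) : subnormal H ->
  exists r, forall x g, H x -> H (iter r (fun w => x ^ w^-1)%g g).
Proof.
move=> [r [C [C0 Cr nC]]]; exists r => x g Hx.
have HC i : (i <= r)%N -> H `<=` C i.
  elim: i => [|i IH] ir; first by rewrite C0.
  by apply: subset_trans (IH (ltnW ir)) _; case: (nC i ir).
suff: forall i, (i <= r)%N -> C (r - i)%N (iter i (fun w => x ^ w^-1)%g g).
  by move=> /(_ r (leqnn r)); rewrite subnn C0.
elim=> [|i IH] ir; first by rewrite subn0 Cr.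
have Cg := IH (ltnW ir).
have lt : (r - i.+1 < r)%N by rewrite ltn_subrL ltn0Sn (leq_ltn_trans _ ir).
rewrite iterS; apply: (normalJ (nC _ lt)); first by apply: HC => //; apply: ltnW.
rewrite subnSK //.
have [_ sC _ _] := nC _ lt; rewrite subnSK // in sC.
by case/subgroupP: sC => _ _; apply.
Qed.

Lemma lift_mx (E D : unitRingType) (f : {rmorphism E -> D}) k l
    (A : 'M[D]_(k, l)) : (forall i j, exists a, A i j = f a) ->
  exists A' : 'M[E]_(k, l), A = map_mx f A'.
Proof.
move=> hA; have /choice[F hF] (ij : 'I_k * 'I_l) : exists a, A ij.1 ij.2 = f a.
  exact: hA.
by exists (\matrix_(i, j) F (i, j)); apply/matrixP => i j; rewrite !mxE -hF.
Qed.

Lemma finite_coordinates (T : choiceType) (I : finType) (R : choiceType)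
    (s : seq R) (A : set T) (u : T -> I -> R) :
  (forall x y, A x -> A y -> (forall i, u x i = u y i) -> x = y) ->
  (forall x i, A x -> u x i \in s) -> finite_set A.
Proof.
move=> uinj us.
pose F x : {ffun I -> option (seq_sub s)} := [ffun i => insub (u x i)].
have Finj : {in A &, injective F}.
  move=> x y /set_mem Ax /set_mem Ay /ffunP eF; apply: uinj => // i.
  have := eF i; rewrite !ffunE (insubT (mem s) (us x i Ax)).
  by rewrite (insubT (mem s) (us y i Ay)) => -[].
by rewrite -(eq_finite_set (inj_card_eq Finj)); apply: finite_finset.
Qed.

Lemma val_GLV n (D : unitRingType) (g : GL n D) :
  val g *m val g^-1%g = 1%:M /\ val g^-1%g *m val g = 1%:M.
Proof. by split; [have := mulgV g|have := mulVg g] => /(congr1 val). Qed.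

Theorem fg_subnormal_GL_scalar (D : unitRingType) (m : nat)
    (N : set (GL m.+2 D)) : GRing.field_axiom D -> strongly_algebraic D ->
  subnormal N -> finitely_generated N -> infinite_set N ->
  forall g, N g -> exists2 a, ring_center D a & val g = a%:M.
Proof.
move=> divD saD snN fgN infN x Nx; apply: contrapT => noscal.
have [XXi XiX] := val_GLV x.
have [p [v [p0 vp vX vXi]]] := transvection_data divD XXi XiX noscal.
pose u (g : GL m.+2 D) : 'M[D]_m.+2 := val g.
have uM : {morph u : g h / (g * h)%g >-> g * h} by [].
have u1 : u 1%g = 1 by [].
have [gens [gH gensP]] := finitely_generated_seq uM u1 fgN.
pose entry (M : 'M[D]_m.+2) (ij : 'I_m.+2 * 'I_m.+2) := M ij.1 ij.2.
pose Y := [seq entry M ij | M <- gens, ij <- enum {: 'I_m.+2 * 'I_m.+2}] ++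
  [seq p i 0 | i <- enum 'I_m.+2] ++ [seq v 0 i | i <- enum 'I_m.+2].
have [E [f [divE algE [g0 spang0] Yf]]] := finite_over_center_cover Y divD saD.
have finj := @division_rmorph_inj _ _ f divE.
have [p1 ep] : exists p1, p = map_mx f p1.
  apply: lift_mx => i j; rewrite ord1; apply: Yf; rewrite !mem_cat.
  apply/orP; right; apply/orP; left.
  by apply: (map_f (fun i => p i 0)); rewrite mem_enum.
have [v1 ev] : exists v1, v = map_mx f v1.
  apply: lift_mx => i j; rewrite ord1; apply: Yf; rewrite !mem_cat.
  apply/orP; right; apply/orP; right.
  by apply: (map_f (fun j => v 0 j)); rewrite mem_enum.
have gens_lift M : M \in gens -> exists M1, M = map_mx f M1.
  move=> Mg; apply: lift_mx => i j; apply: Yf; rewrite mem_cat; apply/orP; left.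
  by apply: (allpairs_f entry (y := (i, j)) Mg); rewrite mem_enum.
have N_lift g : N g -> exists M1, u g = map_mx f M1.
  apply: (gensP [set M | exists M1, M = map_mx f M1]) => //.
    by exists 1%:M; rewrite map_mx1.
  by move=> _ _ [M ->] [M' ->]; exists (M *m M'); rewrite map_mxM.
have sN : subgroup N by case: fgN => ? _ ->; apply: subgroup_generated.
have [N1 NM NV] := (subgroupP N).1 sN.
have [X1 eX] := N_lift _ Nx; have [Xi1 eXi] := N_lift _ (NV _ Nx).
have lift_entry (A : 'M[E]_1) (A' : 'M[D]_1) : A' = map_mx f A -> f (A 0 0) = A' 0 0.
  by move=> ->; rewrite mxE.
have vp1 : (v1 *m p1) 0 0 = 0.
  by apply: finj; rewrite rmorph0 -vp; apply: lift_entry; rewrite map_mxM -ep -ev.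
have vX1 : (v1 *m X1 *m p1) 0 0 != 0.
  apply: contra_neq vX => e; rewrite -(lift_entry (v1 *m X1 *m p1)) ?e ?rmorph0 //.
  by rewrite !map_mxM -ep -ev -eX.
have vXi1 : (v1 *m Xi1 *m p1) 0 0 != 0.
  apply: contra_neq vXi => e; rewrite -(lift_entry (v1 *m Xi1 *m p1)) ?e ?rmorph0 //.
  by rewrite !map_mxM -ep -ev -eXi.
have p10 : p1 != 0 by apply: contra_neq p0 => e; rewrite ep e map_mx0.
have [r iterN] := subnormal_iter_conj snN.
pose P := conj_poly X1 Xi1 p1 v1.
have sizeP : (1 < size (P r).1)%N.
  by have [? [? [_ _ _ _ []]]] := conj_poly_lead divE p10 vX1 vXi1 r.
have [Z [fz [d [e [co [fzP _ coK co_uniq]]]]]] :=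
  center_basis divE (fun x _ => Logic.I : [set: E] x) spang0.
set W := (P r).1 in sizeP.
have [k [l [c Wc]]] : exists k l c, co (lead_coef W k l) c != 0.
  apply: contrapT => no; have : lead_coef W != 0.
    by rewrite lead_coef_eq0 -size_poly_gt0 ltnW.
  case/eqP; apply/matrixP => k l; rewrite mxE (coK (lead_coef W k l)).
  apply: big1 => c _; have [->|Wc] := eqVneq (co (lead_coef W k l) c) 0.
    by rewrite rmorph0 mulr0.
  by case: no; exists k, l, c.
(* One central coordinate of one entry of [W], picked so that the leading term survives and [Q] is
   not constant. *)
pose Q : {poly Z} := \poly_(i < size W) co (W`_i k l) c.
have szQ : size Q = size W.
  apply: size_poly_eq; exact: Wc.
have lQ : lead_coef Q != 0 by rewrite lead_coef_eq0 -size_poly_gt0 szQ ltnW.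
have Zf z : ring_center E (fz z) by apply/(fzP (fz z)); exists z.
have coZ' := coZ coK co_uniq.
have hornerQ t : Q.[t] = co (W.[(fz t)%:M] k l) c.
  rewrite horner_coef szQ horner_coef summxE (co_sum coK co_uniq).
  apply: eq_bigr => i _; rewrite coef_poly ltn_ord -coZ'; congr (co _ c).
  have -> : ((fz t)%:M : 'M[E]_m.+2) ^+ i = (fz (t ^+ i))%:M.
    by rewrite -rmorphXn -rmorphXn.
  by rewrite central_scalar_comm // -mulmxE mul_scalar_mx mxE; apply/esym/Zf.
have [gens1 egens] : exists gens1, gens = [seq map_mx f M | M : 'M[E]_m.+2 <- gens1].
  elim: gens gens_lift {gH gensP Y Yf} => [|M Ms IH] hM; first by exists [::].
  have [|Ms' ->] := IH; first by move=> M' M'Ms; apply: hM; rewrite inE M'Ms orbT.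
  by have [M' ->] := hM M (mem_head _ _); exists (M' :: Ms').
pose L := [seq e i * e j | i <- enum 'I_d, j <- enum 'I_d] ++ 1 ::
  [seq M ij.1 ij.2 | M : 'M[E]_m.+2 <- gens1, ij <- enum {: 'I_m.+2 * 'I_m.+2}].
have [V [A [vV rA AV fA XA]]] := finite_place
  ((lead_coef Q)^-1 :: (Q : seq Z) ++ [seq co y i | y <- L, i <- enum 'I_d]).
have AL y i : y \in L -> A (co y i).
  move=> yL; apply: XA; rewrite inE mem_cat; do 2![apply/orP; right].
  by apply: allpairs_f; rewrite ?mem_enum.
have rLA : subring (lattice co A).
  apply: (lattice_subring fzP coK co_uniq) => // [i j i'|i]; apply: AL.
    rewrite mem_cat; apply/orP; left.
    by apply: (allpairs_f (fun i j => e i * e j)); rewrite mem_enum.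
  by rewrite mem_cat inE eqxx orbT.
have [LA1 _ _] := rLA.
have NA g : N g -> exists2 M1, u g = map_mx f M1 & forall i j, lattice co A (M1 i j).
  apply: (gensP [set M | exists2 M1, M = map_mx f M1 & forall i j, lattice co A (M1 i j)]).
  - exists 1%:M; first by rewrite map_mx1.
    move=> i j; rewrite mxE; case: eqP => _ //; exact: subring0.
  - move=> _ _ [M -> hM] [M' -> hM']; exists (M *m M'); first by rewrite map_mxM.
    by move=> i j; rewrite mxE; apply: subring_sum => // h _; apply: (subringM rLA).
  - move=> M; rewrite egens => /mapP[M1 M1g ->]; exists M1 => // i j i'.
    apply: AL; rewrite mem_cat inE; do 2![apply/orP; right].
    apply: (allpairs_f (fun (M : 'M[E]_m.+2) ij => M ij.1 ij.2)
      (y := (i, j)) M1g).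
    by rewrite mem_enum.
(* An entry of w_r is a polynomial Q in t with values in A, so every t is a root
   of the polynomial Q - Q.[t] over V and V is the whole center. *)
have Vall t : V t.
  have [i1 i2] := conj_poly0_inverse X1 Xi1 vp1 (Zf t).
  pose a0 := map_mx f (P 0%N).1.[(fz t)%:M].
  pose b0 := map_mx f (P 0%N).2.[(fz t)%:M].
  have ab : a0 *m b0 = 1%:M by rewrite -map_mxM [_ *m _]i1 map_mx1.
  have ba : b0 *m a0 = 1%:M by rewrite -map_mxM [_ *m _]i2 map_mx1.
  have inva : `[< invertible_mx a0 >] by apply/asboolP; exists b0.
  pose a : GL m.+2 D := exist _ a0 inva.
  have valV (w : GL m.+2 D) B : val w *m B = 1%:M -> val w^-1%g = B.
    move=> wB; have [_ Vw] := val_GLV w.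
    by rewrite -[LHS]mulmx1 -wB mulmxA Vw mul1mx.
  pose w i := iter i (fun w => x ^ w^-1)%g a.
  have wS i : w i.+1 = (x ^ (w i)^-1)%g by [].
  have conj_val (y z : GL m.+2 D) : val (y ^ z^-1)%g = val z *m val y *m val z^-1%g.
    have -> : (y ^ z^-1 = z * (y * z^-1))%g by rewrite /conjg invgK.
    exact: mulmxA.
  have w_val i : val (w i) = map_mx f (P i).1.[(fz t)%:M] /\
      val (w i)^-1%g = map_mx f (P i).2.[(fz t)%:M].
    elim: i => [|i [IH IH']]; first by split=> //; apply: valV.
    have [h1 h2] := conj_poly_horner X1 Xi1 p1 v1 i (Zf t).
    rewrite wS -conjVg !conj_val IH IH' h1 h2 -!mulmxE !map_mxM.
    by rewrite -[val x]/(u x) -[val x^-1%g]/(u x^-1%g) eX eXi.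
  have [M1 eM1 M1A] := NA _ (iterN x a Nx).
  have AQ : A Q.[t].
    rewrite hornerQ; suff -> : W.[(fz t)%:M] = M1 by apply: M1A.
    have [e1 _] := w_val r; apply/matrixP => i j; apply: finj.
    move: eM1; rewrite /u -/(w r) e1 => /(congr1 (fun M : 'M[D]_m.+2 => M i j)).
    by rewrite !mxE.
  (* As [Q] is not constant, subtracting the value Q(t) leaves its leading coefficient, a unit of
     [V], unchanged. *)
  have szc : (size (- Q.[t]%:P) < size Q)%N.
    by rewrite szQ size_polyN (leq_ltn_trans (size_polyC_leq1 _)).
  have V0 : V 0 by apply: AV; apply: subring0.
  apply: (valuation_ring_integral vV (f := Q - Q.[t]%:P)).
  - apply: coefs_inB; first by case: vV.
      move=> i; have [il|il] := ltnP i (size Q); last by rewrite nth_default.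
      by apply/AV/XA; rewrite inE mem_cat mem_nth ?orbT.
    by apply: coefs_inC => //; apply: AV.
  - by rewrite -lead_coef_eq0 lead_coefDl.
  - by rewrite lead_coefDl //; apply/AV/XA; apply: mem_head.
  - by rewrite hornerD hornerN hornerC subrr.
(* With V = Z the only nonunit is 0, so [A] is contained in the finite list [s], and elements of [N]
   are determined by finitely many coordinates in it. *)
have [s As] := fA.
(* [xget] selects the preimage in [E] of a matrix entry; its default 0 is never taken on [N], whose
   entries all lift. *)
apply: infN; apply: (@finite_coordinates (GL m.+2 D) ('I_m.+2 * 'I_m.+2 * 'I_d)%type Z s N
  (fun (g : GL m.+2 D) ijk => co (xget 0 [set a | val g ijk.1.1 ijk.1.2 = f a]) ijk.2)).
  move=> g h Ng Nh e'; apply: val_inj; apply/matrixP => i j.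
  have [M1 eM1 _] := NA _ Ng; have [M2 eM2 _] := NA _ Nh.
  have get g' M : u g' = map_mx f M ->
      f (xget 0 [set a | val g' i j = f a]) = val g' i j.
    move=> eM; have /(xgetPex 0) : exists a, val g' i j = f a.
      by exists (M i j); rewrite -[val g']/(u g') eM mxE.
    by move=> /= <-.
  rewrite -(get _ _ eM1) -(get _ _ eM2); congr (f _).
  rewrite (coK (xget _ _)) [RHS]coK; apply: eq_bigr => i' _.
  by rewrite (e' (i, j, i')).
move=> g [[i j] i'] Ng /=; have [M1 eM1 M1A] := NA _ Ng.
have -> : xget 0 [set a | val g i j = f a] = M1 i j.
  apply: xget_unique; first by rewrite /= -[val g]/(u g) eM1 mxE.
  by move=> y /= ey; apply: finj; rewrite -ey -[val g]/(u g) eM1 mxE.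
have [z [zs _ mz]] := As _ (M1A i j i').
suff -> : co (M1 i j) i' = z by [].
case: mz => _ [/eqP|nV]; first by rewrite subr_eq0 => /eqP.
by case: nV; apply: Vall.
Qed.

(** * Matrices of size one, and the conclusion *)

Lemma fg_subnormal_GL1_scalar (D : unitRingType) (N : set (GL 1 D)) :
  GRing.field_axiom D -> strongly_algebraic D ->
  subnormal N -> finitely_generated N ->
  forall g, N g -> exists2 a, ring_center D a & val g = a%:M.
Proof.
move=> divD saD snN fgN g Ng.
pose u (h : GL 1 D) : D := val h 0 0.
exists (u g); last exact: mx11_scalar.
apply: (fg_subnormal_central (u := u) divD saD _ _ _ _ snN fgN) => //.
- by move=> h k; rewrite /u [LHS]mxE big_ord1.
- by rewrite /u [LHS]mxE.
- by move=> h k e; apply: val_inj; apply/matrixP => i j; rewrite !ord1.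
- move=> x x0; have Ux := divD x x0.
  have invx : `[< invertible_mx (x%:M : 'M[D]_1) >].
    by apply/asboolP; exists x^-1%:M; rewrite -!scalar_mxM mulrV ?mulVr.
  by exists (exist _ x%:M invx : GL 1 D); rewrite /u mxE.
Qed.

Unset Implicit Arguments.
Set Strict Implicit.

Theorem theorem4p2 (D : unitRingType) (hD : GRing.field_axiom D)
    (hF : strongly_algebraic D) (n : nat) (hn : (1 <= n)%N)
    (N : set (GL n D)) (hN : subnormal N) (hinf : infinite_set N)
    (hfg : finitely_generated N) :
  forall g : GL n D, N g ->
    exists a : D, [/\ ring_center D a, a != 0 & val g = a%:M].
Proof.
move=> g Ng; suff [a Za ga] : exists2 a, ring_center D a & val g = a%:M.
  exists a; split=> //; apply/eqP => a0; have [gV _] := val_GLV g.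
  (* Since n >= 1, the matrices have an entry (0, 0), where a = 0 would give 0 = 1 in the product of
     [g] and its inverse. *)
  case: n hn g gV ga {N hN hinf hfg Ng} => // n _ g gV ga.
  move: gV; rewrite ga a0 raddf0 mul0mx => /matrixP/(_ 0 0)/eqP.
  by rewrite !mxE eq_sym oner_eq0.
case: n hn N hN hinf hfg g Ng => [|[|m]] // _ N hN hinf hfg g Ng.
  exact: fg_subnormal_GL1_scalar hN hfg g Ng.
exact: fg_subnormal_GL_scalar hN hfg hinf g Ng.
Qed.
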